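(* Let $0<\alpha<1$ and let $\theta$ be a non-negative integer-valued random variable with $\operatorname{Var}\theta=0$ (i.e. $\theta$ is a deterministic constant). Let $\Psi=(\psi_t)_{t\ge0}$ have one of the forms listed in (a)–(c) below, and let $\varrho^\Psi=(\varrho^\Psi_t)_{t\ge0}$ be the centered Gaussian process with covariance $$E\varrho^\Psi_s\varrho^\Psi_t=E\theta\int_{\mathbb R}\psi_s(x)\psi_t(x)\,dx+(\operatorname{Var}\theta-E\theta)\int_{\mathbb R}\psi_s(x)\,\mathcal T_2\psi_t(x)\,dx,\qquad s,t\ge0.$$ Then, as $T\to\infty$, the processes $\left(\frac{1}{\sqrt{T^{1-\alpha}}}\varrho^\Psi_{Tt}\right)_{t\ge0}$ converge in the sense of finite dimensional distributions to: (a) a fractional Brownian motion $K\xi^H$ if $\psi_t=1_{[0,t]}$; (b) a sub-fractional Brownian motion $K\zeta^H$ if $\psi_t=1_{[0,t]}-1_{[-t,0]}$; (c) the process $K\eta^H$ if $\psi_t=1_{[-t,t]}$; with $H=\frac{1-\alpha}2$ in each case, where in each case $K$ is a constant.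
   Context: $\mathcal T_t\varphi=p_t*\varphi$, where $p_t$ is the transition density of the standard symmetric $\alpha$-stable Lévy process on $\mathbb R$ (characteristic function $e^{-t|z|^\alpha}$). $1_A$ is the indicator function of $A$. (The process $\varrho^\Psi$ is $(\langle X(1),\psi_t\rangle)_{t\ge0}$, with $X(1)$ the time-$1$ value of the density process of a high-density system of independent $\alpha$-stable particles.) $\xi^H,\zeta^H,\eta^H$ denote continuous centered Gaussian processes indexed by $t\ge0$ with covariances, for $0\le s\le t$, $$E\xi^H_s\xi^H_t=\tfrac12\left(s^{2H}+t^{2H}-|t-s|^{2H}\right),\quad H\in(0,1),$$ $$E\zeta^H_s\zeta^H_t=(1-H)\left(s^{2H}+t^{2H}-\tfrac12\left((s+t)^{2H}+|t-s|^{2H}\right)\right),\quad H\in(0,2),$$ $$E\eta^H_s\eta^H_t=(s+t)^{2H}-|t-s|^{2H},\quad H\in(0,1).$$ The constant $K$ may depend on $\alpha$, on $\theta$ and on the case (a), (b), (c), but not on $t$ or $T$. *)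

(* Defs.v *)
From HB Require Import structures.
From mathcomp Require Import all_boot all_order all_algebra.
From mathcomp Require Import all_classical all_reals all_analysis.

Set Implicit Arguments.
Unset Strict Implicit.
Unset Printing Implicit Defensive.

Import Order.TTheory GRing.Theory Num.Theory.
Import numFieldNormedType.Exports.

Local Open Scope classical_set_scope.
Local Open Scope ring_scope.

(* [p t] is (a version of) the density of the value at time [t] of the standard
   symmetric alpha-stable Levy process: a probability density on R with
   characteristic function z |-> exp (- t |z|^alpha).  The two integrals are the
   real and imaginary parts of the characteristic function. *)
Definition stable_transition_density (R : realType) (alpha : R)
    (p : R -> R -> R) : Prop :=
  forall t : R, 0 < t ->
    [/\ measurable_fun [set: R] (p t),
        forall x, 0 <= p t x,
        (\int[lebesgue_measure]_x (p t x)%:E = 1)%E,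
        forall z : R, (\int[lebesgue_measure]_x (cos (z * x) * p t x)%:E
                       = (expR (- t * `|z| `^ alpha))%:E)%E
      & forall z : R, (\int[lebesgue_measure]_x (sin (z * x) * p t x)%:E
                       = 0)%E].

Definition stable_semigroup (R : realType) (p : R -> R -> R) (t : R)
    (phi : R -> R) (x : R) : R :=
  \int[lebesgue_measure]_(y in [set: R]) (p t (x - y) * phi y).

(* The normal law with mean [m] and standard deviation [s].  The degenerate case
   is spelled out because [normal_prob m 0] is not the Dirac mass at [m]. *)
Definition gaussian_law (R : realType) (m s : R) (A : set R) : \bar R :=
  if s == 0 then \d_m A else normal_prob m s A.

(* Processes are indexed by R, but only their values at times t >= 0 matter. *)
Definition gaussian_process (R : realType) (d : measure_display)
    (Om : measurableType d) (P : probability Om R) (X : R -> {RV P >-> R}) :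
    Prop :=
  forall (n : nat) (t : 'I_n -> R) (a : 'I_n -> R), (forall i, 0 <= t i) ->
    exists m s : R, forall A : set R, measurable A ->
      P [set w | A (\sum_(i < n) a i * X (t i) w)] = gaussian_law m s A.

Definition centered_gaussian_process (R : realType) (d : measure_display)
    (Om : measurableType d) (P : probability Om R) (X : R -> {RV P >-> R}) :
    Prop :=
  gaussian_process X /\ (forall t : R, 0 <= t -> ('E_P[X t] = 0)%E).

Definition has_covariance (R : realType) (d : measure_display)
    (Om : measurableType d) (P : probability Om R) (X : R -> {RV P >-> R})
    (C : R -> R -> R) : Prop :=
  forall s t : R, 0 <= s -> 0 <= t ->
    ('E_P[(fun w => X s w * X t w)%R] = (C s t)%:E)%E.

Definition continuous_paths (R : realType) (d : measure_display)
    (Om : measurableType d) (P : probability Om R) (X : R -> {RV P >-> R}) :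
    Prop :=
  {ae P, forall w, {within `[0, +oo[, continuous (fun t : R => X t w)}}.

(* The covariances of xi^H (fractional Brownian motion, 0 < H < 1), of zeta^H
   (sub-fractional Brownian motion, 0 < H < 2) and of eta^H (0 < H < 1).  The
   formulas are symmetric in s and t, so they need not be restricted to
   s <= t. *)
Definition cov_xi (R : realType) (H s t : R) : R :=
  2^-1 * (s `^ (2 * H) + t `^ (2 * H) - `|t - s| `^ (2 * H)).

Definition cov_zeta (R : realType) (H s t : R) : R :=
  (1 - H) * (s `^ (2 * H) + t `^ (2 * H)
             - 2^-1 * ((s + t) `^ (2 * H) + `|t - s| `^ (2 * H))).

Definition cov_eta (R : realType) (H s t : R) : R :=
  (s + t) `^ (2 * H) - `|t - s| `^ (2 * H).

Definition cov_rho (R : realType) (d0 : measure_display)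
    (Om0 : measurableType d0) (P0 : probability Om0 R)
    (theta : {RV P0 >-> nat}) (p : R -> R -> R) (psi : R -> R -> R)
    (s t : R) : R :=
  let theta_R := fun w => (theta w)%:R : R in
  fine ('E_P0[theta_R])%E
    * \int[lebesgue_measure]_(x in [set: R]) (psi s x * psi t x)
  + (fine ('V_P0[theta_R])%E - fine ('E_P0[theta_R])%E)
    * \int[lebesgue_measure]_(x in [set: R])
        (psi s x * stable_semigroup p 2 (psi t) x).

(* Weak convergence, as T -> +oo, of all finite dimensional distributions of
   (X T t)_{t >= 0} to those of (Y t)_{t >= 0}; the limit may live on another
   probability space. *)
Definition fdd_cvg (R : realType) (d : measure_display)
    (Om : measurableType d) (P : probability Om R)
    (d' : measure_display) (Om' : measurableType d') (P' : probability Om' R)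
    (X : R -> R -> Om -> R) (Y : R -> Om' -> R) : Prop :=
  forall (n : nat) (t : 'I_n -> R), (forall i, 0 <= t i) ->
  forall f : 'rV[R]_n -> R, continuous f ->
    (exists M : R, forall v, `|f v| <= M) ->
    ('E_P[(fun w => f (\row_i X T (t i) w))%R])%E @[T --> +oo]
      --> ('E_P'[(fun w => f (\row_i Y (t i) w))%R])%E.

(* For some constant K, depending only on alpha, theta and psi, the rescaled
   processes rho^Psi converge to K X, where X is a continuous centered Gaussian
   process with covariance C. *)
Definition fdd_scaling_limit (R : realType) (alpha : R) (d0 : measure_display)
    (Om0 : measurableType d0) (P0 : probability Om0 R)
    (theta : {RV P0 >-> nat}) (psi : R -> R -> R) (C : R -> R -> R) : Prop :=
  exists K : R,
  forall p : R -> R -> R, stable_transition_density alpha p ->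
  forall (d : measure_display) (Om : measurableType d) (P : probability Om R)
    (rho : R -> {RV P >-> R}),
    centered_gaussian_process rho ->
    has_covariance rho (cov_rho theta p psi) ->
  forall (d' : measure_display) (Om' : measurableType d')
    (P' : probability Om' R) (X : R -> {RV P' >-> R}),
    centered_gaussian_process X ->
    has_covariance X C ->
    continuous_paths X ->
  fdd_cvg P P'
    (fun T t w => (Num.sqrt (T `^ (1 - alpha)))^-1 * rho (T * t) w)
    (fun t w => K * X t w).

(* Main.v *)
(** Since Var theta = 0, the covariance of rho is E theta times the energy <f, g> - <f, T_2 g>.  For
    indicators of intervals the energy, symmetrised in f and g, is a combination of the values of
    M(v) = int min(|v|, |u|) p_2(u) du at differences of end points.  Tonelli's theorem and the identity
    k min(|v|, |u|) = int (1 - cos zv) (1 - cos zu) z^-2 dz give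
    k M(v) = int (1 - cos zv) (1 - exp(-2 |z|^alpha)) z^-2 dz, so that by scaling and dominated
    convergence M(Tv) is asymptotic to c T^(1 - alpha) |v|^(1 - alpha).

    For centred Gaussian vectors, convergence of covariances gives that of the expectations of
    trigonometric polynomials.  A continuous f bounded by M on R^n differs by at most
    eps + 2 M |x|^2 / N^2 from a trigonometric polynomial, namely a Bernstein polynomial in the variables
    (1 + sin(x_i / N)) / 2; bounded second moments then replace tightness and Levy's theorem. *)

Require Import Defs.
From HB Require Import structures.
From mathcomp Require Import all_boot all_order all_algebra.
From mathcomp Require Import all_classical all_reals all_analysis.
From mathcomp Require Import measurable_realfun.
From mathcomp Require Import ring lra.

Set Implicit Arguments.
Unset Strict Implicit.
Unset Printing Implicit Defensive.

Import Order.TTheory GRing.Theory Num.Theory.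
Import numFieldNormedType.Exports.

Local Open Scope classical_set_scope.
Local Open Scope ring_scope.

(** Each of the two terms of the energy can grow linearly in [T], while their difference has order
    [T^(1 - alpha)]; they are therefore merged into one integral against [p 2] before any limit is
    taken. The order reflects that a stable law with [alpha < 1] has no first moment: [M(v)] is a
    truncated first moment and diverges. The hypotheses give the characteristic function of [p 2]
    and no pointwise bound, hence the Fourier route in place of tail asymptotics; it also yields a
    limit constant that depends on [alpha] alone, so that [K] can be chosen before [p]. A Bernstein
    polynomial is an expectation under independent binomial laws, and the approximation is
    Chebyshev's argument: at far nodes the error is dominated by a multiple of the squared distance,
    whose mean is of order [1 / m]. The sine sends the line into a bounded interval and keeps the
    polynomial trigonometric, but it is injective only near the origin; outside the box [[-N, N]^n]
    the periodic repetitions are paid for by the term [2 M |x|^2 / N^2]. *)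

Section ChangeOfVariable.
Context {R : realType}.
Local Notation mu := (@lebesgue_measure R).

(** [c] times the image of Lebesgue measure under [x |-> c * x + b] agrees with Lebesgue measure on
    half-open intervals, hence on all measurable sets. *)
Lemma ge0_integral_affine (c b : R) (f : R -> \bar R) : 0 < c ->
  measurable_fun [set: R] f -> (forall x, (0 <= f x)%E) ->
  (\int[mu]_x f x = c%:E * \int[mu]_x f (c * x + b)%R)%E.
Proof.
move=> c0 mf f0.
pose phi : measurableTypeR R -> measurableTypeR R := fun x => (c * x + b : R).
have mphi : measurable_fun setT phi.
  by apply: measurable_funD => //; apply: measurable_funM.
pose cn := NngNum (ltW c0).
have := @ge0_integral_pushforward _ _ _ _ R phi mphi mu setT f measurableT mf (fun x _ => f0 x).
rewrite /= preimage_setT => /esym; rewrite [X in X = _](_ : _ = \int[mu]_x f (c * x + b)%R)%E// => ->.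
rewrite -(ge0_integral_mscale _ measurableT cn)//=.
apply: eq_measure_integral => /= A mA _.
apply: lebesgue_measure_unique => //= _ [[x y]] _ <-.
  rewrite /mscale/= /pushforward.
  rewrite (_ : _ @^-1` _ = `](x - b) / c, (y - b) / c]%classic); last first.
    apply/seteqP; split => z /=; rewrite !in_itv/= /phi.
      by rewrite ltr_pdivrMr// ler_pdivlMr// ltrBlDr lerBrDr (mulrC z).
    by rewrite ltr_pdivrMr// ler_pdivlMr// ltrBlDr lerBrDr (mulrC z).
  rewrite !lebesgue_measure_itv/= !lte_fin ltr_pM2r ?invr_gt0// ltrD2r.
  case: ifPn => _; last by rewrite mule0.
  by rewrite -!EFinB -EFinM; congr EFin; field; rewrite gt_eqF.
Qed.

Lemma ge0_integral_opp (f : R -> \bar R) :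
  measurable_fun [set: R] f -> (forall x, (0 <= f x)%E) ->
  (\int[mu]_x f x = \int[mu]_x f (- x)%R)%E.
Proof.
move=> mf f0.
have mN : measurable_fun [set: measurableTypeR R] (-%R : _ -> measurableTypeR R) by [].
have := @ge0_integral_pushforward _ _ _ _ R _ mN mu setT f measurableT mf (fun x _ => f0 x).
rewrite /= preimage_setT => /esym; rewrite [X in X = _](_ : _ = \int[mu]_x f (- x)%R)%E// => ->.
by apply: eq_measure_integral => /= A mA _; rewrite [RHS]lebesgue_measureN.
Qed.

(** A positivity test: [[1, 2]] has length one and stays away from 0. It serves for the constants
    [osc_const b] and for the standard normal mass of [[1, 2]]. *)
Lemma integral_ge_itv12 (f : R -> R) (c : R) : measurable_fun [set: R] f ->
  (forall x, 0 <= f x) -> (forall x, 1 <= x <= 2 -> c <= f x) ->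
  (c%:E <= \int[mu]_x (f x)%:E)%E.
Proof.
move=> mf f0 fc.
apply: (@le_trans _ _ (\int[mu]_(x in `[1%R, 2%R]) (f x)%:E)%E); last first.
  apply: ge0_subset_integral => //=; first exact/measurable_EFinP.
  by move=> x _; rewrite lee_fin.
have [c0|c0] := leP c 0.
  by apply: (@le_trans _ _ 0%E); [rewrite lee_fin|apply: integral_ge0 => x _; rewrite lee_fin].
have -> : (c%:E = \int[mu]_(x in `[1%R, 2%R]) c%:E)%E.
  rewrite integral_cst//= lebesgue_measure_itv/= lte_fin ltr1n.
  by rewrite -EFinB -EFinM; congr EFin; ring.
apply: ge0_le_integral => //=.
- by move=> x _; rewrite lee_fin ltW.
- by apply/measurable_EFinP; apply: measurable_funTS.
Qed.

End ChangeOfVariable.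

(** * Integrability of [(1 - cos z) |z|^(b - 2)] *)

Section Weight.
Context {R : realType}.
Local Notation mu := (@lebesgue_measure R).

Lemma sin_le_id (x : R) : 0 <= x -> sin x <= x.
Proof.
move=> x0; rewrite -subr_ge0.
have d (y : R) : is_derive y 1 (fun y : R => y - sin y) (1 - cos y).
  by apply: is_deriveB.
suff : (fun y : R => y - sin y) 0 <= (fun y : R => y - sin y) x.
  by rewrite /= sin0 subr0.
apply: (@ger0_derive1_le_cc R (fun y : R => y - sin y) 0 x) => //.
- by move=> y _; rewrite derive1E; have [_ ->] := d y; rewrite subr_ge0 cos_le1.
- by apply: derivable_within_continuous => y _; case: (d y).
- by rewrite in_itv/= lexx.
- by rewrite in_itv/= lexx x0.
Qed.

Lemma cos_ge_quad (x : R) : 1 - cos x <= x ^+ 2.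
Proof.
wlog x0 : x / 0 <= x.
  move=> h; have [/h//|x0] := leP 0 x.
  by rewrite -cosN -sqrrN h// oppr_ge0 ltW.
rewrite lerBlDl -lerBlDr -subr_ge0.
have d (y : R) : is_derive y 1 (fun y : R => cos y - (1 - y ^+ 2)) (y *+ 2 - sin y).
  apply: is_derive_eq; rewrite /GRing.scale/=. ring.
suff : (fun y : R => cos y - (1 - y ^+ 2)) 0 <= (fun y : R => cos y - (1 - y ^+ 2)) x.
  by rewrite /= cos0 expr0n/= subr0 subrr.
apply: (@ger0_derive1_le_cc R (fun y : R => cos y - (1 - y ^+ 2)) 0 x) => //.
- move=> y; rewrite in_itv/= => /andP[y0 _].
  rewrite derive1E; have [_ ->] := d y; rewrite subr_ge0 (le_trans (sin_le_id (ltW y0)))//.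
  by rewrite mulr2n lerDl ltW.
- by apply: derivable_within_continuous => y _; case: (d y).
- by rewrite in_itv/= lexx.
- by rewrite in_itv/= lexx x0.
Qed.

Lemma cvgy_powRN (a : R) : 0 < a -> x `^ (- a) @[x --> +oo] --> (0 : R).
Proof.
move=> a0; apply/cvgrPdist_lt => e e0.
near=> x; have x0 : 0 < x by near: x; exact: nbhs_pinfty_gt.
rewrite sub0r normrN ger0_norm ?powR_ge0//.
(* Writing [e] as a power with the same exponent exposes the threshold for [x]. *)
have -> : e = (e `^ (- a^-1)) `^ (- a).
  by rewrite -powRrM mulrN mulNr opprK mulVf ?gt_eqF// powRr1// ltW.
rewrite !powRN ltf_pV2 ?posrE ?powR_gt0 ?invr_gt0 ?powR_gt0//.
rewrite gt0_ltr_powR// ?nnegrE ?invr_ge0 ?powR_ge0 ?ltW//.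
Unshelve. all: by end_near. Qed.

Lemma integral_powR_tail (a : R) : 1 < a ->
  (\int[mu]_(x in `[1%R, +oo[) (x `^ (- a))%:E = ((a - 1)^-1)%:E)%E.
Proof.
move=> a1; have a10 : 0 < a - 1 by rewrite subr_gt0.
pose F (x : R) := - (a - 1)^-1 * x `^ (- (a - 1)).
have dF (x : R) : 0 < x -> is_derive x 1 F (x `^ (- a)).
  move=> x0; have := is_derive1_powR (- (a - 1)) x0 => d.
  apply: is_derive_eq; rewrite /GRing.scale/= ?mulr0 ?add0r.
  rewrite mulrA mulrNN mulVf ?gt_eqF// mul1r; congr (_ `^ _); ring.
rewrite (@ge0_continuous_FTC2y _ (fun x => x `^ (- a)) F 1 0)//.
- by rewrite /F powR1 mulr1 -EFinB sub0r opprK.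
- by move=> x _; rewrite powR_ge0.
- apply: derivable_within_continuous => x; rewrite in_itv/= andbT => x1.
  have x0 : 0 < x by rewrite (lt_le_trans _ x1).
  by case: (is_derive1_powR (- a) x0).
- rewrite -[X in _ --> X](mulr0 (- (a - 1)^-1)).
  by apply: cvgMr; exact: cvgy_powRN.
- by move=> x x1; case: (dF x (lt_trans ltr01 x1)).
- apply: cvg_at_right_filter; apply: differentiable_continuous.
  by apply/derivable1_diffP; case: (dF 1 ltr01).
- move=> x; rewrite in_itv/= andbT => x1; rewrite derive1E.
  by case: (dF x (lt_trans ltr01 x1)).
Qed.

(** The exponent [b = 0] gives the kernel [z^-2] of the identity for [min], and [b = alpha] the
    kernel of the limit. At [z = 0] the factor [1 - cos z] vanishes, whatever the convention for
    powers of 0. *)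
Definition osc_weight (b z : R) : R := (1 - cos z) * `|z| `^ (b - 2).

Lemma osc_weight_ge0 b z : 0 <= osc_weight b z.
Proof. by rewrite mulr_ge0 ?powR_ge0// subr_ge0 cos_le1. Qed.

Lemma measurable_cosM (c : R) : measurable_fun [set: R] (fun z : R => cos (z * c)).
Proof.
apply: (measurableT_comp (f := @cos R)); last by apply: measurable_funM.
by apply: continuous_measurable_fun => x; exact: continuous_cos.
Qed.

Lemma measurable_abs_powR (b : R) : measurable_fun [set: R] (fun z : R => `|z| `^ b).
Proof.
by apply: (measurableT_comp (f := (@powR R)^~ b)); [exact: measurable_powR|exact: normr_measurable].
Qed.

Lemma measurable_osc_weight b : measurable_fun [set: R] (osc_weight b).
Proof.
apply: measurable_funM; last exact: measurable_abs_powR.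
apply: measurable_funB => //.
by have := measurable_cosM 1; under eq_fun do rewrite mulr1.
Qed.

(** On [[-1, 1]] the bound [1 - cos z <= z^2] leaves [|z|^b <= 1], as [0 <= b]; outside,
    [2 |z|^(b - 2)] is integrable because [b < 1]. The function [g] adds these majorants, [h] being
    the right-hand tail. *)
Lemma osc_weight_lty b : 0 <= b < 1 -> (\int[mu]_z (osc_weight b z)%:E < +oo)%E.
Proof.
move=> /andP[b0 b1].
pose h : R -> R := (fun z => z `^ (- (2 - b))) \_ (`[1, +oo[ : set R).
have h0 z : 0 <= h z by rewrite /h patchE; case: ifP => // _; exact: powR_ge0.
have mh : measurable_fun [set: R] h.
  by apply/measurable_restrict => //; apply: measurable_funTS; exact: measurable_powR.
have mhN : measurable_fun [set: R] (fun z => h (- z)) by apply: measurableT_comp.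
have ih : (\int[mu]_z (h z)%:E < +oo)%E.
  rewrite -[X in integral _ _ X]/(EFin \o h) -restrict_EFin.
  rewrite -integral_mkcond integral_powR_tail ?ltry//; lra.
have ihN : (\int[mu]_z (h (- z))%:E < +oo)%E.
  rewrite -(@ge0_integral_opp R (fun z => (h z)%:E))//.
  exact/measurable_EFinP.
pose g z := \1_(`[-1, 1] : set R) z + (2 * h z + 2 * h (- z)).
apply: (@le_lt_trans _ _ (\int[mu]_z (g z)%:E)%E).
  apply: ge0_le_integral => //=.
  - by move=> x _; rewrite lee_fin osc_weight_ge0.
  - by apply/measurable_EFinP; exact: measurable_osc_weight.
  - apply/measurable_EFinP; apply: measurable_funD; first exact: measurable_indic.
    by apply: measurable_funD; apply: measurable_funM.
  - move=> x _; rewrite lee_fin /g indicE mem_setE in_itv/= -ler_norml.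
    have hx := h0 x; have hN := h0 (- x); have [x1|x1] := leP `|x| 1; rewrite ?mulr1n ?mulr0n.
      suff : osc_weight b x <= 1 by lra.
      have [->|xn0] := eqVneq x 0; first by rewrite /osc_weight cos0 subrr mul0r.
      have nx0 : 0 < `|x| by rewrite normr_gt0.
      apply: (@le_trans _ _ (`|x| `^ 2 * `|x| `^ (b - 2))).
        rewrite ler_wpM2r ?powR_ge0// powR_mulrn// real_normK ?num_real//.
        exact: cos_ge_quad.
      rewrite -powRD; last by rewrite (gt_eqF nx0) implybT.
      apply: (@le_trans _ _ (1 `^ (2 + (b - 2)))); last by rewrite powR1.
      by rewrite ge0_ler_powR// ?nnegrE//; lra.
    suff : osc_weight b x <= 2 * (h x + h (- x)) by lra.
    apply: (@le_trans _ _ (2 * `|x| `^ (b - 2))).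
      rewrite ler_wpM2r ?powR_ge0//; have := cos_geN1 x; lra.
    rewrite ler_pM2l//.
    have [x0|x0] := leP 0 x.
      rewrite ger0_norm// in x1 *.
      rewrite {1}/h patchE mem_setE in_itv/= andbT (ltW x1) opprB; lra.
    rewrite ltr0_norm// in x1 *.
    rewrite {2}/h patchE mem_setE in_itv/= andbT (ltW x1) opprB; lra.
rewrite /g; under eq_integral do rewrite EFinD.
rewrite ge0_integralD//=; last 3 first.
- by apply/measurable_EFinP; exact: measurable_indic.
- by move=> x _; rewrite lee_fin addr_ge0// mulr_ge0.
- by apply/measurable_EFinP; apply: measurable_funD; apply: measurable_funM.
apply: lte_add_pinfty.
  by rewrite integral_indic//= setIT lebesgue_measure_itv/= lte_fin; case: ifP; rewrite ?ltry.
under eq_integral do rewrite EFinD !EFinM.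
rewrite ge0_integralD//=; last 4 first.
- by move=> x _; rewrite -EFinM lee_fin mulr_ge0.
- by apply/measurable_EFinP; apply: measurable_funM.
- by move=> x _; rewrite -EFinM lee_fin mulr_ge0.
- by apply/measurable_EFinP; apply: measurable_funM.
rewrite !ge0_integralZl_EFin//=; last 4 first.
- by move=> x _; rewrite lee_fin.
- by apply/measurable_EFinP.
- by move=> x _; rewrite lee_fin.
- by apply/measurable_EFinP.
by apply: lte_add_pinfty; rewrite lte_mul_pinfty// ?ge0_fin_numE ?lee_fin//.
Qed.

End Weight.

(** * Linear combinations of integrable real functions *)

Section IntegrableEFin.
Context {d : measure_display} {T : measurableType d} {R : realType}.
Variable mu : {measure set T -> \bar R}.

Lemma integrable_EFinD (f g : T -> R) : mu.-integrable setT (EFin \o f) ->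
  mu.-integrable setT (EFin \o g) -> mu.-integrable setT (EFin \o (fun x => f x + g x)).
Proof. by move=> hf hg; have := integrableD measurableT hf hg; apply: eq_integrable. Qed.

Lemma integrable_EFinB (f g : T -> R) : mu.-integrable setT (EFin \o f) ->
  mu.-integrable setT (EFin \o g) -> mu.-integrable setT (EFin \o (fun x => f x - g x)).
Proof. by move=> hf hg; have := integrableB measurableT hf hg; apply: eq_integrable. Qed.

Lemma integrable_EFinZ (k : R) (f : T -> R) : mu.-integrable setT (EFin \o f) ->
  mu.-integrable setT (EFin \o (fun x => k * f x)).
Proof. by move=> hf; have := integrableZl measurableT k hf; apply: eq_integrable. Qed.

End IntegrableEFin.

(** * Integrals of [(1 - cos (z v)) |z|^(b - 2)] and the Fourier form of [min] *)

Section Oscillatory.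
Context {R : realType}.
Local Notation mu := (@lebesgue_measure R).

Definition osc (b v z : R) : R := (1 - cos (z * v)) * `|z| `^ (b - 2).

(** For [b = 0] this is the constant [k] of the overview. Its value is [pi], but only finiteness and
    positivity enter. *)
Definition osc_const (b : R) : R := fine (\int[mu]_z (osc_weight b z)%:E).

Lemma osc_ge0 b v z : 0 <= osc b v z.
Proof. by rewrite mulr_ge0 ?powR_ge0// subr_ge0 cos_le1. Qed.

Lemma measurable_osc b v : measurable_fun [set: R] (osc b v).
Proof.
apply: measurable_funM; last exact: measurable_abs_powR.
by apply: measurable_funB => //; exact: measurable_cosM.
Qed.

Lemma osc_constE b : 0 <= b < 1 ->
  (\int[mu]_z (osc_weight b z)%:E = (osc_const b)%:E)%E.
Proof.
move=> bb; rewrite fineK// ge0_fin_numE ?osc_weight_lty//.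
by apply: integral_ge0 => x _; rewrite lee_fin osc_weight_ge0.
Qed.

(** On [[1, 2]], a part of [[0, pi]], both cosine and [x^(b - 2)] decrease, so the integrand is at
    least [(1 - cos 1) 2^(b - 2)] there. *)
Lemma osc_const_gt0 b : 0 <= b < 1 -> 0 < osc_const b.
Proof.
move=> bb; pose c : R := 1 - cos 1.
have c0 : 0 < c by rewrite subr_gt0 -[X in _ < X]cos0 ltr_cos ?ltr01// in_itv/= ?lexx ?pi_ge0//
  ler01/= (le_trans _ (pi_ge2 R))// ler1n.
have := @integral_ge_itv12 R (osc_weight b) (c * 2 `^ (b - 2))
  (measurable_osc_weight b) (osc_weight_ge0 b).
rewrite osc_constE// lee_fin => h.
apply: (@lt_le_trans _ _ (c * 2 `^ (b - 2))); first by rewrite mulr_gt0 ?powR_gt0.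
apply: h => x /andP[x1 x2].
have x0 : 0 < x by lra.
rewrite /osc_weight ler_pM ?powR_ge0 ?(ltW c0)//.
  rewrite /c lerD2l lerN2 leNgt; apply/negP => h.
  have pi2 := pi_ge2 R.
  have m1 : (1 : R) \in `[0, pi] by rewrite in_itv/= ler01/= (le_trans _ pi2)// ler1n.
  have mx : x \in `[0, pi] by rewrite in_itv/= (ltW x0)/= (le_trans _ pi2).
  by have := h; rewrite ltr_cos// ltNge x1.
rewrite (gtr0_norm x0) (_ : b - 2 = - (2 - b)); last by ring.
rewrite !powRN lef_pV2 ?posrE ?powR_gt0//.
by rewrite ge0_ler_powR ?nnegrE ?(ltW x0)//; lra.
Qed.

(** The substitution [z -> |v| z] in the weight, [osc] being even in [v]. At [v = 0] both sides
    vanish, since [b != 1] makes [0^(1 - b)] zero. *)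
Lemma integral_osc b v : 0 <= b < 1 ->
  (\int[mu]_z (osc b v z)%:E = (`|v| `^ (1 - b) * osc_const b)%:E)%E.
Proof.
move=> bb.
have [->|v0] := eqVneq v 0.
  rewrite normr0 powR0 ?mul0r; last by rewrite subr_eq0 eq_sym; case/andP: bb => _ /lt_eqF->.
  by apply: integral0_eq => x _; rewrite /osc mulr0 cos0 subrr mul0r.
have v0' : 0 < `|v| by rewrite normr_gt0.
have oscN z : osc b v z = osc b `|v| z.
  rewrite /osc; congr ((1 - _) * _).
  by case: (ger0P v) => _ //; rewrite mulrN cosN.
under eq_integral do rewrite oscN.
have mw : measurable_fun [set: R] (fun z => (osc_weight b z)%:E).
  by apply/measurable_EFinP; exact: measurable_osc_weight.
have w0 z : (0 <= (osc_weight b z)%:E)%E by rewrite lee_fin osc_weight_ge0.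
have := ge0_integral_affine 0 v0' mw w0; rewrite osc_constE//.
have E z : osc_weight b (`|v| * z + 0) = `|v| `^ (b - 2) * osc b `|v| z.
  rewrite addr0 /osc_weight /osc normrM normr_id (mulrC z) powRM//; ring.
under [X in (_ * X)%E]eq_integral do rewrite E EFinM.
rewrite ge0_integralZl_EFin ?powR_ge0//=; last 2 first.
- by move=> x _; rewrite lee_fin osc_ge0.
- by apply/measurable_EFinP; exact: measurable_osc.
rewrite muleA -EFinM => h.
rewrite EFinM h muleA -EFinM -[X in (X = _)%E]mul1e; congr (_%:E * _)%E.
transitivity (`|v| `^ (1 - b) * (`|v| `^ 1 * `|v| `^ (b - 2))); last by rewrite powRr1.
rewrite -powRD ?(gt_eqF v0') ?implybT// -powRD ?(gt_eqF v0') ?implybT//.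
by rewrite (_ : 1 - b + (1 + (b - 2)) = 0) ?powRr0//; ring.
Qed.

Lemma integrable_osc b v : 0 <= b < 1 -> mu.-integrable [set: R] (EFin \o osc b v).
Proof.
move=> bb; apply/integrableP; split; first by apply/measurable_EFinP; exact: measurable_osc.
under eq_integral do rewrite /= ger0_norm ?osc_ge0//.
by rewrite integral_osc// ltry.
Qed.

Lemma Rintegral_osc b v : 0 <= b < 1 ->
  \int[mu]_z osc b v z = `|v| `^ (1 - b) * osc_const b.
Proof. by move=> bb; rewrite /Rintegral integral_osc. Qed.

(** Product to sum: [(1 - cos x) (1 - cos y)] is [(1 - cos x) + (1 - cos y)] minus half of
    [(1 - cos (x + y)) + (1 - cos (x - y))]. At exponent 0 each term integrates to a multiple of an
    absolute value, and [(|v + u| + |v - u|) / 2] is the maximum of [|v|] and [|u|]. *)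
Lemma integral_osc_cos (v u : R) :
  (\int[mu]_z (osc 0 v z * (1 - cos (z * u)))%:E =
   (Num.min `|v| `|u| * osc_const 0)%:E)%E.
Proof.
have b0 : 0 <= (0 : R) < 1 by rewrite lexx ltr01.
pose g1 z := osc 0 v z + osc 0 u z.
pose g2 z := 2^-1 * (osc 0 (v + u) z + osc 0 (v - u) z).
have ig1 : mu.-integrable [set: R] (EFin \o g1).
  by apply: integrable_EFinD; exact: integrable_osc.
have ig2' : mu.-integrable [set: R] (EFin \o (fun z => (osc 0 (v + u) z + osc 0 (v - u) z))).
  by apply: integrable_EFinD; exact: integrable_osc.
have ig2 : mu.-integrable [set: R] (EFin \o g2) by apply: integrable_EFinZ.
have E z : osc 0 v z * (1 - cos (z * u)) = g1 z - g2 z.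
  rewrite /g1 /g2 /osc (mulrDr z v u) (mulrBr z v u) cosB cosD; by field.
have : \int[mu]_z (g1 z - g2 z) = Num.min `|v| `|u| * osc_const 0.
  rewrite RintegralB// RintegralZl// !RintegralD ?Rintegral_osc//; try exact: integrable_osc.
  rewrite subr0 !powRr1//.
  have -> : Num.min `|v| `|u| = `|v| + `|u| - 2^-1 * (`|v + u| + `|v - u|); last by ring.
  rewrite minEle; case: (ger0P v); case: (ger0P u); case: (ger0P (v + u));
    case: (ger0P (v - u)) => ? ? ? ?; case: leP => ?; lra.
move=> h; transitivity (\int[mu]_z (g1 z - g2 z))%:E; last by rewrite h.
rewrite fineK.
  by apply: eq_integral => z _; rewrite E.
by apply: integrable_fin_num => //; exact: integrable_EFinB.
Qed.

End Oscillatory.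

(** * The truncated first moment and its Fourier representation *)

Section MinIntegral.
Context {R : realType}.
Local Notation mu := (@lebesgue_measure R).
Variables (p : R -> R).
Hypotheses (mp : measurable_fun [set: R] p) (p0 : forall x, 0 <= p x)
  (p1 : (\int[mu]_x (p x)%:E = 1)%E).

Lemma integrable_density : mu.-integrable [set: R] (EFin \o p).
Proof.
apply/integrableP; split; first exact/measurable_EFinP.
by under eq_integral do rewrite /= ger0_norm//; rewrite p1 ltry.
Qed.

Lemma integrable_bounded_density (f : R -> R) (M : R) : measurable_fun [set: R] f ->
  (forall x, `|f x| <= M) -> mu.-integrable [set: R] (EFin \o (fun x => f x * p x)).
Proof.
move=> mf fM.
have M0 : 0 <= M by exact: le_trans (fM 0).
apply: (@le_integrable _ _ _ mu setT measurableT _ (EFin \o (fun x => M * p x))).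
- by apply/measurable_EFinP; exact: measurable_funM.
- move=> x _ /=; rewrite lee_fin normrM [leRHS]ger0_norm ?mulr_ge0//.
  by rewrite (ger0_norm (p0 x)) ler_wpM2r.
- exact/integrable_EFinZ/integrable_density.
Qed.

Definition min_integral (v : R) : R := \int[mu]_u (Num.min `|v| `|u| * p u).

Lemma measurable_min_norm (v : R) :
  measurable_fun [set: R] (fun u : R => Num.min `|v| `|u|).
Proof. by apply: measurable_minr => //; exact: normr_measurable. Qed.

Lemma min_norm_ge0 (v u : R) : 0 <= Num.min `|v| `|u|.
Proof. by rewrite le_min !normr_ge0. Qed.

(** The truncation at [|v|] gives finiteness even when [p] has no first moment, as for a stable law
    with [alpha < 1]. *)
Lemma integrable_min_integral (v : R) :
  mu.-integrable [set: R] (EFin \o (fun u => Num.min `|v| `|u| * p u)).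
Proof.
apply: (@integrable_bounded_density _ `|v|); first exact: measurable_min_norm.
by move=> x; rewrite ger0_norm ?min_norm_ge0// ge_min lexx.
Qed.

Lemma min_integralE (v : R) :
  (\int[mu]_u (Num.min `|v| `|u| * p u)%:E = (min_integral v)%:E)%E.
Proof. by rewrite fineK//; apply: integrable_fin_num => //; exact: integrable_min_integral. Qed.

Lemma min_integral_norm v : min_integral `|v| = min_integral v.
Proof. by rewrite /min_integral normr_id. Qed.

Lemma min_integral0 : min_integral 0 = 0.
Proof.
rewrite /min_integral (_ : (fun u => _) = cst 0); first by rewrite Rintegral_cst// mul0r.
by apply/funext => u; rewrite normr0 min_l ?mul0r.
Qed.

(** Tonelli for the nonnegative kernel [F]: integrating in [u] first produces [1 - phi z],
    integrating in [z] first produces the minimum through [integral_osc_cos]. *)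
Lemma min_integral_fourier (phi : R -> R) (v : R) :
  measurable_fun [set: R] phi ->
  (forall z : R, (\int[mu]_x (cos (z * x) * p x)%:E = (phi z)%:E)%E) ->
  (\int[mu]_z (osc 0 v z * (1 - phi z))%:E = (osc_const 0 * min_integral v)%:E)%E.
Proof.
move=> mphi hphi.
have b0 : 0 <= (0 : R) < 1 by rewrite lexx ltr01.
pose F (x : R * R) : \bar R := (osc 0 v x.1 * (1 - cos (x.1 * x.2)) * p x.2)%:E.
have F0 x : (0 <= F x)%E.
  by rewrite lee_fin mulr_ge0// mulr_ge0 ?osc_ge0// subr_ge0 cos_le1.
have mF : measurable_fun [set: R * R] F.
  apply/measurable_EFinP; apply: measurable_funM.
    apply: measurable_funM.
      by apply: (measurableT_comp (measurable_osc 0 v)); exact: measurable_fst.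
    apply: measurable_funB => //.
    apply: (measurableT_comp (f := @cos R)).
      by apply: continuous_measurable_fun => x; exact: continuous_cos.
    by apply: measurable_funM; [exact: measurable_fst|exact: measurable_snd].
  by apply: (measurableT_comp mp); exact: measurable_snd.
have := @fubini_tonelli _ _ _ _ _ mu mu F mF F0.
have L z : (\int[mu]_u F (z, u) = (osc 0 v z * (1 - phi z))%:E)%E.
  rewrite /F/=; under eq_integral do rewrite -mulrA EFinM.
  rewrite ge0_integralZl_EFin ?osc_ge0//=; last 2 first.
  - by move=> x _; rewrite lee_fin mulr_ge0// subr_ge0 cos_le1.
  - apply/measurable_EFinP; apply: measurable_funM => //; apply: measurable_funB => //.
    by under eq_fun do rewrite mulrC; exact: measurable_cosM.
  rewrite [RHS]EFinM; congr (_ * _)%E.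
  under eq_integral do rewrite mulrBl mul1r EFinB.
  rewrite integralB_EFin//; first by rewrite p1 hphi -EFinB.
    exact: integrable_density.
  apply: (@integrable_bounded_density _ 1).
    by under eq_fun do rewrite mulrC; exact: measurable_cosM.
  by move=> x; rewrite ler_norml cos_geN1 cos_le1.
under eq_integral do rewrite L.
move=> ->.
under eq_integral => u _.
  rewrite /F/=; under eq_integral do rewrite mulrC EFinM.
  rewrite ge0_integralZl_EFin//=; last 2 first.
  - by move=> x _; rewrite lee_fin mulr_ge0 ?osc_ge0// subr_ge0 cos_le1.
  - apply/measurable_EFinP; apply: measurable_funM; first exact: measurable_osc.
    by apply: measurable_funB => //; exact: measurable_cosM.
  rewrite integral_osc_cos -EFinM mulrA (mulrC _ (osc_const 0)) (mulrC (p u)) EFinM.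
  over.
rewrite ge0_integralZl_EFin ?(ltW (osc_const_gt0 b0))//=; last 2 first.
- by move=> x _; rewrite lee_fin mulr_ge0 ?min_norm_ge0.
- by apply/measurable_EFinP; apply: measurable_funM => //; exact: measurable_min_norm.
by rewrite min_integralE EFinM.
Qed.

End MinIntegral.

(** * Small frequencies: dilation, and the linearisation of [1 - exp (- x)] *)

Section Scaling.
Context {R : realType}.
Local Notation mu := (@lebesgue_measure R).

Lemma one_sub_expRN_ge0 (x : R) : 0 <= x -> 0 <= 1 - expR (- x).
Proof. by move=> x0; rewrite subr_ge0 -expR0 ler_expR oppr_le0. Qed.

Lemma one_sub_expRN_le (x : R) : 1 - expR (- x) <= x.
Proof. have := expR_ge1Dx (- x); lra. Qed.

Lemma one_sub_expRN_ge (x : R) : 0 <= x -> x / (1 + x) <= 1 - expR (- x).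
Proof.
move=> x0; have x1 : 0 < 1 + x by lra.
have h : expR (- x) <= (1 + x)^-1.
  by rewrite expRN lef_pV2 ?posrE ?expR_gt0// expR_ge1Dx.
have -> : x / (1 + x) = 1 - (1 + x)^-1 by field; rewrite gt_eqF.
lra.
Qed.

(** Squeeze, from [y / (1 + y) <= 1 - exp (- y) <= y] at [y = x / s n]. *)
Lemma cvg_scaled_expRN (s : R^nat) (x : R) : 0 <= x -> (forall n, 0 < s n) ->
  s @ \oo --> +oo ->
  s n * (1 - expR (- (x / s n))) @[n --> \oo] --> x.
Proof.
move=> x0 s0 sy.
have sV : (s n)^-1 @[n --> \oo] --> (0 : R).
  by apply/gtr0_cvgV0; [near=> n; exact: s0|exact: sy].
apply: (@squeeze_cvgr _ _ _ _ (fun n => x / (1 + x * (s n)^-1)) (fun=> x)).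
- near=> n; have sn := s0 n.
  have y0 : 0 <= x / s n by rewrite divr_ge0// ltW.
  apply/andP; split.
    rewrite -ler_pdivrMl// (le_trans _ (one_sub_expRN_ge y0))//.
    by rewrite mulrA (mulrC _ x).
  by rewrite -ler_pdivlMl// mulrC one_sub_expRN_le.
- rewrite -[X in _ --> X](_ : x / (1 + x * 0) = x); last by rewrite mulr0 addr0 divr1.
  apply: cvgMr; apply: cvgV; first by rewrite mulr0 addr0 oner_eq0.
  by apply: cvgD; [exact: cvg_cst|apply: cvgMr].
- exact: cvg_cst.
Unshelve. all: by end_near. Qed.

(** Under [z -> z / t] the kernel [z^-2] contributes [t^2] and the Jacobian [t^-1]. *)
Lemma integral_osc_dilation (t v : R) (h : R -> R) : 0 < t ->
  measurable_fun [set: R] h -> (forall z, 0 <= h z) ->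
  (\int[mu]_z (osc 0 (t * v) z * h z)%:E =
   t%:E * \int[mu]_z (osc 0 v z * h (z / t))%:E)%E.
Proof.
move=> t0 mh h0; have tV0 : 0 < t^-1 by rewrite invr_gt0.
have mf : measurable_fun [set: R] (fun z => (osc 0 (t * v) z * h z)%:E).
  by apply/measurable_EFinP/measurable_funM => //; exact: measurable_osc.
have f0 z : (0 <= (osc 0 (t * v) z * h z)%:E)%E by rewrite lee_fin mulr_ge0 ?osc_ge0.
rewrite (ge0_integral_affine 0 tV0 mf f0).
have mh' : measurable_fun [set: R] (fun z => h (z / t)).
  by apply: (measurableT_comp mh); apply: measurable_funM.
rewrite -!ge0_integralZl_EFin//=.
- apply: eq_integral => z _; rewrite -!EFinM; congr EFin.
  rewrite addr0 (mulrC t^-1 z) mulrA.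
  suff -> : osc 0 (t * v) (z / t) = t ^+ 2 * osc 0 v z.
    by field; rewrite gt_eqF.
  rewrite /osc (_ : z / t * (t * v) = z * v); last by field; rewrite gt_eqF.
  rewrite normrM (gtr0_norm tV0) powRM ?(ltW tV0)// (_ : t^-1 `^ (0 - 2) = t ^+ 2); first by ring.
  by rewrite sub0r powRN powR_mulrn ?(ltW tV0)// exprVn invrK.
all: try by rewrite ltW.
all: try by move=> z _; rewrite lee_fin mulr_ge0 ?osc_ge0.
- by apply/measurable_EFinP/measurable_funM => //; exact: measurable_osc.
- by apply: (measurableT_comp mf); apply: measurable_funD => //; apply: measurable_funM.
Qed.

End Scaling.

(** * Asymptotics of the truncated first moment *)

Section MinIntegralLimit.
Context {R : realType}.
Local Notation mu := (@lebesgue_measure R).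
Variables (alpha : R) (p : R -> R).
Hypotheses (alpha0 : 0 < alpha) (alpha1 : alpha < 1).
Hypotheses (mp : measurable_fun [set: R] p) (p0 : forall x, 0 <= p x)
  (p1 : (\int[mu]_x (p x)%:E = 1)%E)
  (pcos : forall z : R, (\int[mu]_x (cos (z * x) * p x)%:E
                       = (expR (- 2 * `|z| `^ alpha))%:E)%E).

(** The factor 2 comes from [1 - exp (- 2 |z|^alpha) ~ 2 |z|^alpha] at small [z]; dividing by
    [osc_const 0] removes the factor in [min_integral_fourier]. *)
Definition scaling_const : R := 2 * osc_const alpha / osc_const 0.

Lemma scaling_const_ge0 : 0 <= scaling_const.
Proof.
by rewrite divr_ge0 ?mulr_ge0 ?ltW// osc_const_gt0// ?lexx ?ltr01// (ltW alpha0).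
Qed.

Lemma cvg_min_integral (v : R) :
  min_integral p (t * v) / t `^ (1 - alpha) @[t --> +oo] -->
  scaling_const * `|v| `^ (1 - alpha).
Proof.
have b0 : 0 <= (0 : R) < 1 by rewrite lexx ltr01.
have ba : 0 <= alpha < 1 by rewrite (ltW alpha0).
have k0 := osc_const_gt0 b0.
(* Dominated convergence is sequential, so the limit is taken along sequences; finitely many terms
   are then reset to 1 to make all of them positive. *)
apply/cvg_pinftyP => u uy.
wlog u0 : u uy / forall n, 0 < u n.
  move=> W.
  have ne : \forall n \near \oo, 0 < u n by move/cvgryPgt : uy; apply.
  pose w n := if 0 < u n then u n else 1.
  have uw : \forall n \near \oo, u n = w n by near=> n; rewrite /w ifT//; near: n.
  have wy : w @ \oo --> +oo by apply: cvg_trans uy; apply: near_eq_cvg.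
  apply: cvg_trans (W w wy _); last by move=> n; rewrite /w; case: ifPn.
  by apply: near_eq_cvg; near=> n; rewrite -(near uw n).
(* The dilation yields a factor [u n]; dividing by [u n]^ (1 - alpha)[leaves]u n [^ alpha], which
   balances the decay of [h (z / u n)]. *)
pose s n := u n `^ alpha.
have s0 n : 0 < s n by rewrite powR_gt0.
have sy : s @ \oo --> +oo.
  apply/cvgryPgt => A; near=> n.
  have A1 : 0 <= Num.max A 0 by rewrite le_max lexx orbT.
  apply: (@le_lt_trans _ _ (Num.max A 0)); first by rewrite le_max lexx.
  have -> : Num.max A 0 = (Num.max A 0 `^ alpha^-1) `^ alpha.
    by rewrite -powRrM mulVf ?gt_eqF// powRr1.
  rewrite gt0_ltr_powR ?nnegrE ?powR_ge0 ?(ltW (u0 n))//.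
  by near: n; move/cvgryPgt : uy; apply.
pose h (z : R) := 1 - expR (- 2 * `|z| `^ alpha).
have mh : measurable_fun [set: R] h.
  apply: measurable_funB => //; apply: (measurableT_comp (f := @expR R)) => //.
  by apply: measurable_funM => //; exact: measurable_abs_powR.
have h0 z : 0 <= h z.
  by rewrite /h mulNr one_sub_expRN_ge0// mulr_ge0 ?powR_ge0.
pose f n z := osc 0 v z * (s n * h (z / u n)).
have fE n z : f n z = osc 0 v z * (s n * (1 - expR (- (2 * `|z| `^ alpha / s n)))).
  rewrite /f /h mulNr normrM powRM// normfV (gtr0_norm (u0 n)).
  rewrite /s -!powR_inv1 ?powR_ge0 ?(ltW (u0 n))// -!powRrM mulN1r mulrN1.
  by congr (_ * (_ * (1 - expR (- _)))); ring.
(* [g] is both the pointwise limit of the [f n] and, by [1 - exp (- y) <= y], a majorant of each of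
   them. *)
pose g z := 2 * osc alpha v z.
have gE z : g z = osc 0 v z * (2 * `|z| `^ alpha).
  have [->|z0] := eqVneq z 0.
    by rewrite /g /osc !mul0r cos0 subrr !mul0r mulr0.
  rewrite /g /osc; have -> : `|z| `^ (alpha - 2) = `|z| `^ (0 - 2) * `|z| `^ alpha.
    by rewrite -powRD; [congr (_ `^ _); ring|rewrite normr_eq0 z0 implybT].
  by ring.
have intg : mu.-integrable [set: R] (EFin \o g).
  by apply: integrable_EFinZ; exact: integrable_osc.
have mf n : measurable_fun [set: R] (f n).
  apply: measurable_funM; first exact: measurable_osc.
  apply: measurable_funM; first exact: measurable_cst.
  by apply: (measurableT_comp mh); apply: measurable_funM.
have f0 n z : 0 <= f n z.
  by rewrite mulr_ge0 ?osc_ge0// mulr_ge0// ltW.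
have fg n z : `|f n z| <= g z.
  rewrite ger0_norm// fE gE ler_wpM2l ?osc_ge0//.
  by rewrite -ler_pdivlMl// mulrC one_sub_expRN_le.
have cvf : (\int[mu]_z (f n z)%:E)%E @[n --> \oo] --> (\int[mu]_z (g z)%:E)%E.
  apply: (@dominated_cvg _ _ _ mu setT measurableT (fun n z => (f n z)%:E)
    (fun z => (g z)%:E) (fun z => (g z)%:E)).
  - by move=> n; apply/measurable_EFinP; exact: mf.
  - move=> z _; apply: cvg_EFin; first by near=> n.
    rewrite gE; rewrite (_ : _ \o _ =
        fun n => osc 0 v z * (s n * (1 - expR (- (2 * `|z| `^ alpha / s n))))); last first.
      by apply/funext => n; rewrite /= fE.
    by apply: cvgMr; apply: cvg_scaled_expRN => //; rewrite mulr_ge0 ?powR_ge0.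
  - by [].
  - exact: intg.
  - by move=> n z _; rewrite lee_fin fg.
(* The Fourier representation at [u n * v], followed by the dilation. *)
have E n : (\int[mu]_z (f n z)%:E = (osc_const 0 * (min_integral p (u n * v) / u n `^ (1 - alpha)))%:E)%E.
  have := min_integral_fourier mp p0 p1 (u n * v) _ pcos.
  have mphi : measurable_fun [set: R] (fun z : R => expR (- 2 * `|z| `^ alpha)).
    apply: (measurableT_comp (f := @expR R)) => //.
    by apply: measurable_funM => //; exact: measurable_abs_powR.
  move=> /(_ mphi); rewrite (integral_osc_dilation v (u0 n) mh h0) => H.
  under eq_integral do rewrite /f mulrCA EFinM.
  rewrite ge0_integralZl_EFin ?(ltW (s0 n))//=; last 2 first.
  - by move=> z _; rewrite lee_fin mulr_ge0 ?osc_ge0.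
  - apply/measurable_EFinP/measurable_funM; first exact: measurable_osc.
    by apply: (measurableT_comp mh); apply: measurable_funM.
  rewrite mulrA EFinM -H muleAC -EFinM; congr (_%:E * _)%E.
  rewrite /s powRB ?(gt_eqF (u0 n)) ?implybT// powRr1 ?(ltW (u0 n))// invf_div.
  by rewrite mulrCA divff ?mulr1// gt_eqF.
have ig : (\int[mu]_z (g z)%:E = (osc_const 0 * (scaling_const * `|v| `^ (1 - alpha)))%:E)%E.
  under eq_integral do rewrite EFinM.
  rewrite ge0_integralZl_EFin//=; last 2 first.
  - by move=> z _; rewrite lee_fin osc_ge0.
  - by apply/measurable_EFinP; exact: measurable_osc.
  rewrite integral_osc// -EFinM; congr EFin; rewrite /scaling_const.
  by field; rewrite gt_eqF.
move: cvf; rewrite ig; under eq_fun do rewrite E.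
move=> /fine_cvgP[_] /= H.
have kn0 := lt0r_neq0 k0.
suff : (fun n => (osc_const 0)^-1 * (osc_const 0 * (min_integral p (u n * v) / u n `^ (1 - alpha))))
    @ \oo --> (osc_const 0)^-1 * (osc_const 0 * (scaling_const * `|v| `^ (1 - alpha))).
  by under eq_fun do rewrite mulKf//; rewrite mulKf.
by apply: cvgMr.
Unshelve. all: by end_near. Qed.

End MinIntegralLimit.

(** * Energies of indicators of intervals *)

Section Energy.
Context {R : realType}.
Local Notation mu := (@lebesgue_measure R).
Local Notation ind a b := (\1_(`[a, b] : set R) : R -> R).

Lemma ge0_integral_reflect (x : R) (f : R -> \bar R) :
  measurable_fun [set: R] f -> (forall y, (0 <= f y)%E) ->
  (\int[mu]_y f y = \int[mu]_u f (x - u)%R)%E.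
Proof.
move=> mf f0.
have mfN : measurable_fun [set: R] (fun y : R => f (- y)) by apply: measurableT_comp.
rewrite ge0_integral_opp//.
rewrite (@ge0_integral_affine R 1 (- x) (fun y => f (- y)%R))// mul1e.
by apply: eq_integral => u _; rewrite mul1r opprD opprK addrC.
Qed.

Variable p : R -> R.
Hypotheses (mp : measurable_fun [set: R] p) (p0 : forall x, 0 <= p x)
  (p1 : (\int[mu]_x (p x)%:E = 1)%E).

(** For the density [p 2] this unfolds to [stable_semigroup p 2]. *)
Definition smooth (f : R -> R) (x : R) : R :=
  \int[mu]_(y in [set: R]) (p (x - y) * f y).

(** For [a <= b] and [c <= d], the length of the intersection of [[a, b]] and [[c + u, d + u]],
    written as a second difference of absolute values so that it can be matched with [min]. *)
Definition overlap (a b c d u : R) : R :=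
  2^-1 * (`|b - c - u| + `|a - d - u| - `|a - c - u| - `|b - d - u|).

Lemma integral_ind_overlap a b c d u : a <= b -> c <= d ->
  (\int[mu]_x (ind a b x * ind c d (x - u))%:E = (overlap a b c d u)%:E)%E.
Proof.
move=> ab cd.
rewrite (_ : (fun x => _) =
    EFin \o (\1_(`[Num.max a (c + u), Num.min b (d + u)] : set R))); last first.
  apply/funext => x /=; rewrite !indicE !mem_setE !in_itv/= -natrM mulnb.
  rewrite lerBrDr lerBlDr ge_max le_min; congr (_%:R%:E).
  by rewrite !andbA; congr nat_of_bool; do 4 case: (_ <= _).
rewrite integral_indic//= setIT lebesgue_measure_itv/= lte_fin.
rewrite /overlap -EFinB -(fun_if (@EFin R)); congr EFin.
rewrite maxEle minEle.
(* Both sides are piecewise linear; every sign pattern, an empty intersection included, is a matter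
   of linear arithmetic. *)
case: (ger0P (b - c - u)); case: (ger0P (a - d - u)); case: (ger0P (a - c - u));
  case: (ger0P (b - d - u)) => ? ? ? ?;
  case: (leP a (c + u)) => ?; case: (leP b (d + u)) => ?; case: ifPn; rewrite -?leNgt => ?; lra.
Qed.

Lemma integral_ind_overlap0 a b c d : a <= b -> c <= d ->
  (\int[mu]_x (ind a b x * ind c d x)%:E = (overlap a b c d 0)%:E)%E.
Proof.
move=> ab cd; rewrite -integral_ind_overlap//.
by apply: eq_integral => x _; rewrite subr0.
Qed.

Lemma overlap_bound a b c d u : a <= b -> c <= d -> `|overlap a b c d u| <= b - a.
Proof.
move=> ab cd; rewrite ler_norml /overlap.
case: (ger0P (b - c - u)); case: (ger0P (a - d - u)); case: (ger0P (a - c - u));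
  case: (ger0P (b - d - u)) => ? ? ? ?; apply/andP; split; lra.
Qed.

Lemma measurable_overlap a b c d : measurable_fun [set: R] (overlap a b c d).
Proof.
have m (v : R) : measurable_fun [set: R] (fun u : R => `|v - u|).
  apply: (measurableT_comp (f := @Num.norm R R)); first exact: normr_measurable.
  by apply: measurable_funB.
apply: measurable_funM => //; apply: measurable_funB; last exact: m.
by apply: measurable_funB; last exact: m; apply: measurable_funD; exact: m.
Qed.

Lemma integrable_overlap a b c d : a <= b -> c <= d ->
  mu.-integrable [set: R] (EFin \o (fun u => overlap a b c d u * p u)).
Proof.
move=> ab cd; apply: (integrable_bounded_density mp p0 p1 (M := b - a)).
  exact: measurable_overlap.
by move=> u; exact: overlap_bound.
Qed.

Lemma measurable_ind (a b : R) : measurable_fun [set: R] (ind a b).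
Proof. exact: measurable_indic. Qed.

Lemma ind_ge0 (a b x : R) : 0 <= ind a b x.
Proof. by rewrite indicE. Qed.

Lemma ind_le1 (a b x : R) : ind a b x <= 1.
Proof. by rewrite indicE; case: (_ \in _). Qed.

Lemma measurable_shift (x : R) : measurable_fun [set: R] (fun y => p (x - y)).
Proof. by apply: (measurableT_comp mp); apply: measurable_funB. Qed.

Lemma integrable_smooth c d x :
  mu.-integrable [set: R] (EFin \o (fun y => p (x - y) * ind c d y)).
Proof.
have mps := measurable_shift x.
apply: (@le_integrable _ _ _ mu setT measurableT _ (EFin \o (fun y => p (x - y)))).
- by apply/measurable_EFinP/measurable_funM => //; exact: measurable_ind.
- move=> y _ /=; rewrite lee_fin normrM ler_piMr//.
  by rewrite ger0_norm ?ind_ge0// ind_le1.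
- apply/integrableP; split; first exact/measurable_EFinP.
  under eq_integral do rewrite /= ger0_norm//.
  have := @ge0_integral_reflect x (fun y => (p y)%:E).
  by rewrite p1 => <-//; rewrite ?ltry//; exact/measurable_EFinP.
Qed.

(** Substituting [y = x - u] moves the shift from the density to the indicator, so that a later
    integration in [x] meets two indicators only. *)
Lemma smoothE c d x : (\int[mu]_u (p u * ind c d (x - u))%:E = (smooth (ind c d) x)%:E)%E.
Proof.
rewrite fineK; last by apply: integrable_fin_num => //; exact: integrable_smooth.
rewrite (@ge0_integral_reflect x (fun y => (p (x - y) * ind c d y)%:E)).
- by apply: eq_integral => u _; rewrite subKr.
- by apply/measurable_EFinP/measurable_funM; [exact: measurable_shift|exact: measurable_ind].
- by move=> y; rewrite lee_fin mulr_ge0 ?ind_ge0.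
Qed.

Lemma smoothB c d c' d' x :
  smooth (fun y => ind c d y - ind c' d' y) x = smooth (ind c d) x - smooth (ind c' d') x.
Proof.
rewrite /smooth -RintegralB//; last 2 first.
- exact: integrable_smooth.
- exact: integrable_smooth.
by apply: eq_Rintegral => y _; rewrite mulrBr.
Qed.

(** Tonelli: for fixed [u] the integral in [x] is the overlap of [[a, b]] with a translate of
    [[c, d]]. *)
Lemma integral_ind_smooth a b c d : a <= b -> c <= d ->
  (\int[mu]_x (ind a b x * smooth (ind c d) x)%:E =
   \int[mu]_u (overlap a b c d u * p u)%:E)%E.
Proof.
move=> ab cd.
pose F (z : R * R) : \bar R := (ind a b z.1 * (p z.2 * ind c d (z.1 - z.2)))%:E.
have F0 z : (0 <= F z)%E by rewrite lee_fin !mulr_ge0 ?ind_ge0.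
have mF : measurable_fun [set: R * R] F.
  apply/measurable_EFinP; apply: measurable_funM.
    by apply: (measurableT_comp (measurable_ind a b)); exact: measurable_fst.
  apply: measurable_funM.
    by apply: (measurableT_comp mp); exact: measurable_snd.
  apply: (measurableT_comp (measurable_ind c d)).
  by apply: measurable_funB; [exact: measurable_fst|exact: measurable_snd].
have := @fubini_tonelli _ _ _ _ _ mu mu F mF F0.
have L x : (\int[mu]_u F (x, u) = (ind a b x * smooth (ind c d) x)%:E)%E.
  rewrite /F/=; under eq_integral do rewrite EFinM.
  rewrite ge0_integralZl_EFin ?ind_ge0//=; last 2 first.
  - by move=> u _; rewrite lee_fin mulr_ge0 ?ind_ge0.
  - apply/measurable_EFinP/measurable_funM => //.
    by apply: (measurableT_comp (measurable_ind c d)); apply: measurable_funB.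
  by rewrite smoothE EFinM.
under eq_integral do rewrite L.
move=> ->; apply: eq_integral => u _.
rewrite /F/=; under eq_integral do rewrite mulrCA EFinM.
rewrite ge0_integralZl_EFin//=.
- by rewrite integral_ind_overlap// -EFinM mulrC.
- apply/measurable_EFinP/measurable_funM; first exact: measurable_ind.
  by apply: (measurableT_comp (measurable_ind c d)); apply: measurable_funB.
Qed.

Definition energy (f g : R -> R) : R :=
  \int[mu]_(x in [set: R]) (f x * g x) - \int[mu]_(x in [set: R]) (f x * smooth g x).

Lemma smooth_ge0 c d x : 0 <= smooth (ind c d) x.
Proof. by apply: Rintegral_ge0 => y _; rewrite mulr_ge0 ?ind_ge0. Qed.

(** As [p] has mass one, the constant [overlap a b c d 0] can be put under the integral, where the
    linear growth cancels. *)
Lemma energy_ind a b c d : a <= b -> c <= d ->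
  energy (ind a b) (ind c d) =
  \int[mu]_(u in [set: R]) ((overlap a b c d 0 - overlap a b c d u) * p u).
Proof.
move=> ab cd; rewrite /energy.
rewrite [X in X - _]/Rintegral.
rewrite integral_ind_overlap0//= [X in _ - X]/Rintegral integral_ind_smooth//.
rewrite -[fine (\int[mu]_u _)]/(\int[mu]_u (overlap a b c d u * p u)).
under [RHS]eq_Rintegral do rewrite mulrBl.
rewrite RintegralB//; last 2 first.
- exact/integrable_EFinZ/integrable_density.
- exact: integrable_overlap.
rewrite RintegralZl//; last exact: integrable_density.
by rewrite [\int[mu]_x p x]/Rintegral p1 mulr1.
Qed.

(** For each difference [v] of end points, one order of the pair supplies [|v - u|] and the other
    [|v + u|]; together with [|v|] they give the minimum of [|v|] and [|u|], less [|u|]. The terms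
    [|u|] cancel between two plus and two minus signs. *)
Lemma energy_ind_sym a b c d : a <= b -> c <= d ->
  energy (ind a b) (ind c d) + energy (ind c d) (ind a b) =
  min_integral p (b - c) + min_integral p (a - d)
  - min_integral p (a - c) - min_integral p (b - d).
Proof.
move=> ab cd; rewrite !energy_ind//.
have io a' b' c' d' : a' <= b' -> c' <= d' -> mu.-integrable [set: R]
    (EFin \o (fun u => (overlap a' b' c' d' 0 - overlap a' b' c' d' u) * p u)).
  move=> ab' cd'; have := integrable_EFinB
    (integrable_EFinZ (overlap a' b' c' d' 0) (integrable_density mp p0 p1))
    (integrable_overlap ab' cd').
  by apply: eq_integrable => // u _ /=; rewrite mulrBl.
rewrite -RintegralD//; [|exact: io|exact: io].
have im v := integrable_min_integral mp p0 p1 v.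
rewrite /min_integral -RintegralD// -RintegralB//; last exact: integrable_EFinD.
rewrite -RintegralB//; last by apply: integrable_EFinB => //; exact: integrable_EFinD.
apply: eq_Rintegral => u _; rewrite -!mulrDl -!mulrBl; congr (_ * _).
have m (v : R) : Num.min `|v| `|u| = `|v| + `|u| - 2^-1 * (`|v + u| + `|v - u|).
  rewrite minEle; case: (ger0P v); case: (ger0P u); case: (ger0P (v + u));
    case: (ger0P (v - u)) => ? ? ? ?; case: leP => ?; lra.
rewrite !m /overlap !subr0.
have N (x y : R) : `|y - x - u| = `|x - y + u| by rewrite -normrN; congr `|_|; ring.
rewrite (distrC d a) (distrC c b) (distrC c a) (distrC d b) (N a d) (N b c) (N a c) (N b d).
lra.
Qed.

Lemma integrable_ind_ind a b c d : a <= b -> c <= d ->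
  mu.-integrable [set: R] (EFin \o (fun x => ind a b x * ind c d x)).
Proof.
move=> ab cd; apply/integrableP; split.
  by apply/measurable_EFinP/measurable_funM; exact: measurable_ind.
under eq_integral do rewrite /= ger0_norm ?mulr_ge0 ?ind_ge0//.
by rewrite integral_ind_overlap0// ltry.
Qed.

Lemma measurable_smooth_ind c d : measurable_fun [set: R] (smooth (ind c d)).
Proof.
pose F (z : R * R) : \bar R := (p (z.1 - z.2) * ind c d z.2)%:E.
apply: (measurableT_comp (f := fine) (g := fun x => \int[mu]_y F (x, y))%E) => //.
have F0 z : (0 <= F z)%E by rewrite lee_fin mulr_ge0 ?ind_ge0.
have mF : measurable_fun [set: R * R] F.
  apply/measurable_EFinP/measurable_funM.
    apply: (measurableT_comp mp).
    by apply: measurable_funB; [exact: measurable_fst|exact: measurable_snd].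
  by apply: (measurableT_comp (measurable_ind c d)); exact: measurable_snd.
by apply: measurable_fun_fubini_tonelli_F => //; exact: mF.
Qed.

Lemma integrable_ind_smooth a b c d : a <= b -> c <= d ->
  mu.-integrable [set: R] (EFin \o (fun x => ind a b x * smooth (ind c d) x)).
Proof.
move=> ab cd; apply/integrableP; split.
  apply/measurable_EFinP/measurable_funM; [exact: measurable_ind|exact: measurable_smooth_ind].
under eq_integral do rewrite /= ger0_norm ?mulr_ge0 ?ind_ge0 ?smooth_ge0//.
rewrite integral_ind_smooth//.
have := integrable_fin_num measurableT (integrable_overlap ab cd).
by move=> /fineK <-; rewrite ltry.
Qed.

Lemma energyB a b a' b' c d c' d' : a <= b -> a' <= b' -> c <= d -> c' <= d' ->
  energy (fun x => ind a b x - ind a' b' x) (fun x => ind c d x - ind c' d' x) =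
  energy (ind a b) (ind c d) - energy (ind a b) (ind c' d')
  - energy (ind a' b') (ind c d) + energy (ind a' b') (ind c' d').
Proof.
move=> ab ab' cd cd'; rewrite /energy.
have E (f1 f2 g1 g2 : R -> R) :
    mu.-integrable [set: R] (EFin \o (fun x => f1 x * g1 x)) ->
    mu.-integrable [set: R] (EFin \o (fun x => f1 x * g2 x)) ->
    mu.-integrable [set: R] (EFin \o (fun x => f2 x * g1 x)) ->
    mu.-integrable [set: R] (EFin \o (fun x => f2 x * g2 x)) ->
  \int[mu]_(x in [set: R]) ((f1 x - f2 x) * (g1 x - g2 x)) =
  \int[mu]_(x in [set: R]) (f1 x * g1 x) - \int[mu]_(x in [set: R]) (f1 x * g2 x)
  - \int[mu]_(x in [set: R]) (f2 x * g1 x) + \int[mu]_(x in [set: R]) (f2 x * g2 x).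
  move=> i11 i12 i21 i22.
  rewrite -RintegralB// -RintegralB//; last exact: integrable_EFinB.
  rewrite -RintegralD//; last by apply: integrable_EFinB => //; exact: integrable_EFinB.
  by apply: eq_Rintegral => x _; ring.
rewrite E; [|exact: integrable_ind_ind..].
under [X in _ - X]eq_Rintegral do rewrite smoothB.
rewrite E; [|exact: integrable_ind_smooth..].
by do 8! move: (Rintegral _ _ _) => ?; ring.
Qed.

End Energy.

(** * Reduction of normal laws to the standard one *)

Section StandardNormal.
Context {R : realType}.
Local Notation mu := (@lebesgue_measure R).
Local Notation nu := (@normal_prob R 0 1).

(** The absolute value is there because [s] may be negative; the density depends on [s^2] only. *)
Lemma normal_pdf_affine (m s z : R) : s != 0 ->
  normal_pdf m s (`|s| * z + m) = `|s|^-1 * normal_pdf 0 1 z.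
Proof.
move=> s0; rewrite !normal_pdfE ?oner_eq0// /normal_fun mulrA.
have ns0 : `|s| != 0 by rewrite normr_eq0.
congr (_ * expR _).
  by rewrite /normal_peak expr1n mul1r -mulrnAr sqrtrM ?sqr_ge0// sqrtr_sqr invfM.
rewrite addrK subr0 expr1n exprMn real_normK ?num_real//.
by field.
Qed.

Lemma normal_probE (m s : R) (A : set R) : s != 0 -> measurable A ->
  normal_prob m s A = nu ((fun z => m + `|s| * z) @^-1` A).
Proof.
move=> s0 mA; rewrite /normal_prob.
have ns0 : 0 < `|s| by rewrite normr_gt0.
rewrite [LHS]integral_mkcond [RHS]integral_mkcond.
have mf : measurable_fun [set: R] ((fun x => (normal_pdf m s x)%:E) \_ A).
  apply/measurable_restrict => //; apply: measurable_funTS.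
  by apply/measurable_EFinP; exact: measurable_normal_pdf.
have f0 x : (0 <= ((fun x => (normal_pdf m s x)%:E) \_ A) x)%E.
  by rewrite patchE; case: ifP => // _; rewrite lee_fin normal_pdf_ge0.
rewrite (ge0_integral_affine m ns0 mf f0) -ge0_integralZl_EFin//.
- apply: eq_integral => z _; rewrite !patchE.
  rewrite (_ : (z \in (fun z => m + `|s| * z) @^-1` A) = (`|s| * z + m \in A)); last first.
    by rewrite -[LHS]/(m + `|s| * z \in A) addrC.
  case: ifP => _; last by rewrite mule0.
  by rewrite normal_pdf_affine// -EFinM mulrA divff ?mul1r// gt_eqF.
- by apply: (measurableT_comp mf); apply: measurable_funD => //; apply: measurable_funM.
Qed.

Lemma normal_prob_opp (A : set R) : measurable A -> nu (-%R @^-1` A) = nu A.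
Proof.
move=> mA; rewrite /normal_prob [LHS]integral_mkcond [RHS]integral_mkcond.
have mf : measurable_fun [set: R] ((fun x => (normal_pdf 0 1 x)%:E) \_ A).
  apply/measurable_restrict => //; apply: measurable_funTS.
  by apply/measurable_EFinP; exact: measurable_normal_pdf.
have f0 x : (0 <= ((fun x => (normal_pdf 0 1 x)%:E) \_ A) x)%E.
  by rewrite patchE; case: ifP => // _; rewrite lee_fin normal_pdf_ge0.
rewrite [RHS]ge0_integral_opp//; apply: eq_integral => z _; rewrite !patchE.
rewrite (_ : (z \in -%R @^-1` A) = (- z \in A)); last by [].
case: ifP => // _; congr EFin.
by rewrite !normal_pdfE ?oner_eq0// /normal_fun !subr0 sqrrN.
Qed.

(** The density decreases on [[1, 2]], so its value at 2 is a lower bound. The positivity of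
    [normal_var] rests on this. *)
Lemma normal_itv12_gt0 : (0 < nu (`[1%R, 2%R]%classic : set R))%E.
Proof.
rewrite /normal_prob integral_mkcond.
pose f : R -> R := (normal_pdf 0 1) \_ (`[1, 2]%classic).
have f0 x : 0 <= f x by rewrite /f patchE; case: ifP => // _; rewrite normal_pdf_ge0.
have mf : measurable_fun [set: R] f.
  by apply/measurable_restrict => //; apply: measurable_funTS; exact: measurable_normal_pdf.
have c0 : 0 < normal_pdf 0 1 (2 : R).
  by rewrite normal_pdfE ?oner_eq0// mulr_gt0 ?expR_gt0// normal_peak_gt0// oner_eq0.
apply: (@lt_le_trans _ _ (normal_pdf 0 1 (2 : R))%:E); first by rewrite lte_fin.
have := @integral_ge_itv12 R f (normal_pdf 0 1 2) mf f0.
rewrite -[X in integral _ _ X]/(EFin \o f) -restrict_EFin; apply => x /andP[x1 x2].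
rewrite /f patchE mem_setE in_itv/= x1 x2 !normal_pdfE ?oner_eq0//.
rewrite ?ler_wpM2l ?normal_peak_ge0// /normal_fun ler_expR !subr0.
rewrite ler_pM2r; last by rewrite invr_gt0 expr1n.
by rewrite lerN2 ler_sqr ?nnegrE; lra.
Qed.

End StandardNormal.

(** * Integrals against the standard normal law *)

Section StandardNormalIntegral.
Context {R : realType}.
Local Notation nu := (@normal_prob R 0 1).

(** By symmetry of the law the integral is its own opposite, and integrability makes it finite. *)
Lemma normal_integral_odd (f : R -> R) : measurable_fun [set: R] f ->
  (forall x, f (- x) = - f x) -> nu.-integrable [set: R] (EFin \o f) ->
  (\int[nu]_x (f x)%:E = 0)%E.
Proof.
move=> mf fN fi.
have mN : measurable_fun [set: measurableTypeR R] (-%R : _ -> measurableTypeR R) by [].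
have mEf : measurable_fun [set: R] (EFin \o f) by apply/measurable_EFinP.
have fNi : nu.-integrable (-%R @^-1` [set: R]) ((EFin \o f) \o -%R).
  rewrite preimage_setT.
  have := integrableN fi; apply: eq_integrable => // x _ /=.
  by rewrite fN.
have := @integral_pushforward _ _ _ _ R _ mN nu setT (EFin \o f) mEf fNi measurableT.
rewrite preimage_setT => h.
have {}h : (\int[nu]_x (f x)%:E = \int[nu]_x (- f x)%:E)%E.
  transitivity (\int[nu]_x (EFin \o f \o -%R) x)%E; last first.
    by apply: eq_integral => x _ /=; rewrite fN.
  rewrite -h; apply: eq_measure_integral => A mA _.
  by rewrite [RHS](normal_prob_opp mA).
have fin : (\int[nu]_x (f x)%:E)%E \is a fin_num by apply: integrable_fin_num.
have : (\int[nu]_x (- f x)%:E = - \int[nu]_x (f x)%:E)%E.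
  under eq_integral do rewrite EFinN.
  by rewrite integralN//; exact: integrable_add_def.
rewrite -h => e.
have := e; rewrite -(fineK fin) => /eqP; rewrite -EFinN eqe => /eqP e'.
by congr EFin; lra.
Qed.

Lemma integrable_bounded d (T : measurableType d) (P : probability T R) (f : T -> R) (M : R) :
  measurable_fun setT f -> (forall x, `|f x| <= M) -> P.-integrable setT (EFin \o f).
Proof.
move=> mf fM; apply: measurable_bounded_integrable => //.
  by apply: (le_lt_trans (probability_le1 P measurableT)); rewrite ltry.
exists M; split; first exact: num_real.
by move=> x Mx y _ /=; rewrite (le_trans (fM y))// ltW.
Qed.

(** [fine] returns 0 on an infinite integral; [normal_var_lty] excludes that case as soon as a
    nondegenerate Gaussian variable with finite second moment is at hand. *)
Definition normal_var : R := fine (\int[nu]_z (z ^+ 2)%:E).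

(* The value at 1 of the characteristic function of a centred normal law, as a function of its
   variance.  In fact [normal_var] is 1, but only its finiteness and positivity are needed. *)
Definition gauss_cf (q : R) : R := \int[nu]_z cos (Num.sqrt (q / normal_var) * z).

Lemma measurable_cos_scale (c : R) : measurable_fun [set: R] (fun z : R => cos (c * z)).
Proof. by under eq_fun do rewrite mulrC; exact: measurable_cosM. Qed.

Lemma gauss_cfE q : (\int[nu]_z (cos (Num.sqrt (q / normal_var) * z))%:E = (gauss_cf q)%:E)%E.
Proof.
rewrite fineK//; apply: integrable_fin_num => //.
apply: (@integrable_bounded _ _ _ _ 1); first exact: measurable_cos_scale.
by move=> x; rewrite ler_norml cos_geN1 cos_le1.
Qed.

Lemma gauss_cf_continuous (u : R^nat) (l : R) :
  u @ \oo --> l -> gauss_cf (u n) @[n --> \oo] --> gauss_cf l.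
Proof.
move=> ul.
pose f n (z : R) := (cos (Num.sqrt (u n / normal_var) * z))%:E.
pose g (z : R) := (cos (Num.sqrt (l / normal_var) * z))%:E.
have : (\int[nu]_z f n z)%E @[n --> \oo] --> (\int[nu]_z g z)%E.
  apply: (@dominated_cvg _ _ _ nu setT measurableT f g (cst 1%:E)).
  - by move=> n; apply/measurable_EFinP; exact: measurable_cos_scale.
  - move=> z _; apply: cvg_EFin; first by near=> n.
    apply: (cvg_comp (fun n => Num.sqrt (u n / normal_var) * z) (@cos R)); last exact: continuous_cos.
    apply: cvgMl.
    apply: (cvg_comp (fun n => u n / normal_var) (@Num.sqrt R)); last exact: sqrt_continuous.
    by apply: cvgMl.
  - by [].
  - exact: finite_measure_integrable_cst.
  - by move=> n z _; rewrite lee_fin ler_norml cos_geN1 cos_le1.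
rewrite /f /g; under eq_fun do rewrite gauss_cfE.
by rewrite gauss_cfE => /fine_cvgP[_].
Unshelve. all: by end_near. Qed.

Lemma gauss_cf_cvgy (q : R -> R) (l : R) :
  q @ +oo --> l -> gauss_cf (q t) @[t --> +oo] --> gauss_cf l.
Proof.
move=> ql; apply/cvg_pinftyP => u uy; apply: gauss_cf_continuous.
by move/cvg_pinftyP : ql; apply.
Qed.

End StandardNormalIntegral.

(** * Variables with a Gaussian law of unknown parameters *)

Section GaussianLaw.
Context {R : realType} {d : measure_display} {Om : measurableType d} (P : probability Om R).
Local Notation nu := (@normal_prob R 0 1).

Variables (Y : Om -> R) (m s : R).
Hypothesis mY : measurable_fun [set: Om] Y.
Hypothesis lawY : forall A : set R, measurable A -> P (Y @^-1` A) = gaussian_law m s A.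

(** One formula for both cases of [gaussian_law]: if [s = 0] the affine map is constant and the
    image law is the Dirac mass at [m]. *)
Lemma gaussian_lawE (A : set R) : measurable A ->
  gaussian_law m s A = nu ((fun z => m + `|s| * z) @^-1` A).
Proof.
move=> mA; rewrite /gaussian_law; case: ifPn => [/eqP->|s0]; last exact: normal_probE.
rewrite normr0 (_ : (_ @^-1` A) = if m \in A then setT else set0); last first.
  apply/seteqP; split => z /=; rewrite mul0r addr0.
    by move=> mAm; rewrite mem_set.
  by case: ifPn => // /set_mem.
rewrite diracE; case: ifPn => _; last by rewrite measure0.
by rewrite probability_setT.
Qed.

Let mY' : measurable_fun [set: Om] (Y : Om -> measurableTypeR R) := mY.

Lemma measurable_affine_law : measurable_fun [set: measurableTypeR R]
  (fun z : measurableTypeR R => (m + `|s| * z : R) : measurableTypeR R).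
Proof. by apply: measurable_funD => //; apply: measurable_funM. Qed.

Lemma gaussian_ge0_integral (f : R -> \bar R) : measurable_fun [set: R] f ->
  (forall x, (0 <= f x)%E) ->
  (\int[P]_w f (Y w) = \int[nu]_z f (m + `|s| * z)%R)%E.
Proof.
move=> mf f0.
have h1 := @ge0_integral_pushforward _ _ _ _ R _ mY' P setT f measurableT mf (fun x _ => f0 x).
have h2 := @ge0_integral_pushforward _ _ _ _ R _ measurable_affine_law nu setT f
  measurableT mf (fun x _ => f0 x).
rewrite preimage_setT in h1; rewrite preimage_setT in h2.
transitivity (\int[P]_w (f \o Y) w)%E => //; rewrite -h1.
transitivity (\int[nu]_z (f \o (fun z => m + `|s| * z)%R) z)%E => //; rewrite -h2.
apply: eq_measure_integral; first exact: measurable_affine_law.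
move=> mf' A mA _.
by apply: etrans (gaussian_lawE mA); apply: lawY.
Qed.

Lemma gaussian_integral (f : R -> R) : measurable_fun [set: R] f ->
  P.-integrable setT (EFin \o (f \o Y)) ->
  nu.-integrable setT (EFin \o (fun z => f (m + `|s| * z))) ->
  (\int[P]_w (f (Y w))%:E = \int[nu]_z (f (m + `|s| * z))%:E)%E.
Proof.
move=> mf fi1 fi2.
have mEf : measurable_fun [set: R] (EFin \o f) by apply/measurable_EFinP.
have h1 := @integral_pushforward _ _ _ _ R _ mY' P setT (EFin \o f) mEf fi1 measurableT.
have h2 := @integral_pushforward _ _ _ _ R _ measurable_affine_law nu setT (EFin \o f) mEf fi2 measurableT.
rewrite preimage_setT in h1; rewrite preimage_setT in h2.
transitivity (\int[P]_w (EFin \o f \o Y) w)%E => //; rewrite -h1.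
transitivity (\int[nu]_z (EFin \o f \o (fun z => m + `|s| * z)%R) z)%E => //; rewrite -h2.
apply: eq_measure_integral; first exact: measurable_affine_law.
move=> mf' A mA _.
by apply: etrans (gaussian_lawE mA); apply: lawY.
Qed.

(** The moment is transferred backwards, from [Y] to the standard law, by
    [s^2 z^2 <= 2 ((m + |s| z)^2 + m^2)]. *)
Lemma normal_var_lty : s != 0 -> (\int[P]_w (Y w ^+ 2)%:E < +oo)%E ->
  nu.-integrable setT (EFin \o (fun z : R => z ^+ 2)).
Proof.
move=> s0; have ns0 : 0 < `|s| by rewrite normr_gt0.
rewrite (@gaussian_ge0_integral (fun x => (x ^+ 2)%:E)); last 2 first.
- by apply/measurable_EFinP; exact: measurable_funX.
- by move=> x; rewrite lee_fin sqr_ge0.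
move=> hfin.
have mq : measurable_fun [set: R] (fun z : R => (m + `|s| * z) ^+ 2).
  by apply: measurable_funX; exact: measurable_affine_law.
have i1 : nu.-integrable setT (EFin \o (fun z : R => (m + `|s| * z) ^+ 2)).
  apply/integrableP; split; first exact/measurable_EFinP.
  by under eq_integral do rewrite /= ger0_norm ?sqr_ge0//.
have i2 : nu.-integrable setT (EFin \o cst (m ^+ 2)) by apply: finite_measure_integrable_cst.
have i3 := integrable_EFinZ (2 / s ^+ 2) (integrable_EFinD i1 i2).
apply: (le_integrable _ _ _ i3) => //.
  by apply/measurable_EFinP; exact: measurable_funX.
move=> z _ /=; rewrite lee_fin ger0_norm ?sqr_ge0//.
apply: le_trans (ler_norm _).
have s2 : 0 < s ^+ 2 by rewrite -real_normK ?num_real// exprn_gt0.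
rewrite mulrAC ler_pdivlMr// -(real_normK (num_real s)) -subr_ge0.
rewrite (_ : _ - _ = (`|s| * z + 2 * m) ^+ 2); first exact: sqr_ge0.
by ring.
Qed.

(** A Gaussian process provides [m] and [s] only existentially, so they are first identified from
    the moments: [m = 0] and [q = s^2 normal_var]. The sine integral then vanishes by symmetry. *)
Lemma gaussian_cf (q : R) : (\int[P]_w (Y w)%:E = 0)%E ->
  P.-integrable setT (EFin \o Y) ->
  (\int[P]_w (Y w ^+ 2)%:E = q%:E)%E ->
  (\int[P]_w (cos (Y w))%:E = (gauss_cf q)%:E)%E /\
  (\int[P]_w (sin (Y w))%:E = 0)%E.
Proof.
move=> EY iY EY2.
(* For [s = 0] the variable says nothing about [normal_var], hence the separate case and the
   conditional positivity. *)
have EYm : 0 = m /\ q = `|s| ^+ 2 * normal_var /\ (s != 0 -> 0 < normal_var :> R).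
  have [s0|s0] := eqVneq s 0.
    have e (f : R -> R) : measurable_fun [set: R] f ->
        P.-integrable setT (EFin \o (f \o Y)) -> (\int[P]_w (f (Y w))%:E = (f m)%:E)%E.
      have c z : m + `|s| * z = m by rewrite s0 normr0 mul0r addr0.
      move=> mf fi; rewrite gaussian_integral//.
        rewrite (_ : (fun z => _) = cst (f m)%:E).
          by rewrite integral_cst//= probability_setT mule1.
        by apply/funext => z; rewrite c.
      rewrite (_ : EFin \o _ = EFin \o cst (f m)).
        exact: finite_measure_integrable_cst.
      by apply/funext => z /=; rewrite c.
    have e1 := e id (@measurable_id _ _ _) iY.
    have m0 : m = 0 by apply/eqP; rewrite -eqe -e1 EY.
    split=> //; split=> //; rewrite s0 normr0 expr0n/= mul0r.
    have := e (fun x => x ^+ 2) (measurable_funX _ (@measurable_id _ _ _)).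
    have i2 : P.-integrable setT (EFin \o ((fun x : R => x ^+ 2) \o Y)).
      apply/integrableP; split; first by apply/measurable_EFinP; exact: measurable_funX.
      by under eq_integral do rewrite /= ger0_norm ?sqr_ge0//; rewrite EY2 ltry.
    by move=> /(_ i2); rewrite EY2 m0 expr0n/= => -[].
  have i2 : nu.-integrable setT (EFin \o (fun z : R => z ^+ 2)).
    by apply: normal_var_lty => //; rewrite EY2 ltry.
  have i0 (c : R) : nu.-integrable setT (EFin \o cst c) by apply: finite_measure_integrable_cst.
  have i1 : nu.-integrable setT (EFin \o (@id R)).
    apply: (le_integrable _ _ _ (integrable_EFinD (i0 1) i2)) => //.
      exact/measurable_EFinP.
    move=> z _ /=; rewrite lee_fin; apply: le_trans (ler_norm _).
    by rewrite ler_norml; apply/andP; split; nra.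
  have z1 : (\int[nu]_z z%:E = 0)%E.
    by apply: (@normal_integral_odd R id).
  have ns0 : 0 < `|s| by rewrite normr_gt0.
  have m0 : m = 0.
    have := gaussian_integral (@measurable_id _ _ _) iY.
    have ia : nu.-integrable setT (EFin \o (fun z : R => m + `|s| * z)).
      by apply: (integrable_EFinD (i0 m)); exact: integrable_EFinZ.
    move=> /(_ ia); rewrite /= EY.
    under eq_integral do rewrite EFinD EFinM.
    rewrite integralD//; [|exact: (i0 m)|exact: (integrable_EFinZ `|s| i1)].
    rewrite integral_cst//= probability_setT mule1 integralZl//.
    by rewrite z1 mule0 adde0 => -[].
  split=> //.
  have V : (\int[nu]_z (z ^+ 2)%:E = (normal_var : R)%:E)%E.
    by rewrite /normal_var fineK//; apply: integrable_fin_num.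
  split.
    have := gaussian_ge0_integral (f := fun x => (x ^+ 2)%:E) _ _.
    rewrite EY2 m0; under eq_integral do rewrite add0r exprMn EFinM.
    rewrite ge0_integralZl_EFin ?sqr_ge0//; last 2 first.
    - by move=> x _; rewrite lee_fin sqr_ge0.
    - by apply/measurable_EFinP; exact: measurable_funX.
    rewrite V -EFinM => h; apply/eqP; rewrite -eqe; apply/eqP; apply: h.
    - by apply/measurable_EFinP; exact: measurable_funX.
    - by move=> x; rewrite lee_fin sqr_ge0.
  (* [z^2] dominates the indicator of [[1, 2]], which has positive mass. *)
  move=> _; rewrite -lte_fin -V.
  apply: (lt_le_trans (@normal_itv12_gt0 R)).
  rewrite -[X in nu X]setIT -(integral_indic nu measurableT)//.
  apply: ge0_le_integral => //=.
  - by apply/measurable_EFinP; exact: measurable_indic.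
  - by apply/measurable_EFinP; exact: measurable_funX.
  - move=> x _; rewrite lee_fin indicE mem_setE in_itv/=.
    by case: (boolP (1 <= x <= 2)) => [|_]; rewrite ?sqr_ge0//= => /andP[x1 _]; rewrite expr_ge1//; lra.
case: EYm => m0 [qE Vpos].
(* If [s = 0] then [q = 0], and the quotient is 0 whatever [normal_var] is. *)
have sq : Num.sqrt (q / normal_var) = `|s|.
  have [s0|s0] := eqVneq s 0.
    by rewrite qE s0 normr0 expr0n/= mul0r mul0r sqrtr0.
  by rewrite qE mulfK ?sqrtr_sqr ?normr_id// gt_eqF// Vpos.
have mcos : measurable_fun [set: R] (@cos R).
  by apply: continuous_measurable_fun => x; exact: continuous_cos.
have msin : measurable_fun [set: R] (@sin R).
  by apply: continuous_measurable_fun => x; exact: continuous_sin.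
have mz : measurable_fun [set: R] (fun z : R => m + `|s| * z) by exact: measurable_affine_law.
split.
  rewrite gaussian_integral//.
  - by rewrite -gauss_cfE sq -m0; under eq_integral do rewrite add0r.
  - apply: (@integrable_bounded _ _ _ _ _ 1); first by apply: (measurableT_comp mcos).
    by move=> x; rewrite ler_norml cos_geN1 cos_le1.
  - apply: (@integrable_bounded _ _ _ _ _ 1); first by apply: (measurableT_comp mcos).
    by move=> x; rewrite ler_norml cos_geN1 cos_le1.
have isn : nu.-integrable setT (EFin \o (fun z => sin (m + `|s| * z))).
  apply: (@integrable_bounded _ _ _ _ _ 1); first by apply: (measurableT_comp msin).
  by move=> x; rewrite ler_norml sin_geN1 sin_le1.
rewrite gaussian_integral//.
  apply: normal_integral_odd => //; first by apply: (measurableT_comp msin).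
  by move=> x; rewrite -m0 !add0r mulrN sinN.
apply: (@integrable_bounded _ _ _ _ _ 1); first by apply: (measurableT_comp msin).
by move=> x; rewrite ler_norml sin_geN1 sin_le1.
Qed.

End GaussianLaw.

(** * Linear combinations of the values of a centred Gaussian process *)

Section GaussianProcess.
Context {R : realType} {d : measure_display} {Om : measurableType d} (P : probability Om R).
Variables (X : R -> {RV P >-> R}) (C : R -> R -> R).
Hypotheses (gX : centered_gaussian_process X) (cX : has_covariance X C).

(** [has_covariance] at equal times says that the second moment is a real number, hence finite. *)
Lemma integrable_sqr (t : R) : 0 <= t ->
  P.-integrable setT (EFin \o (fun w => X t w ^+ 2)).
Proof.
move=> t0; apply/integrableP; split; first by apply/measurable_EFinP; exact: measurable_funX.
under eq_integral do rewrite /= ger0_norm ?sqr_ge0//.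
have := cX t0 t0; rewrite unlock => h.
by rewrite (_ : \int[P]_x _ = (C t t)%:E)%E ?ltry// -h.
Qed.

Lemma integrable_mul (s t : R) : 0 <= s -> 0 <= t ->
  P.-integrable setT (EFin \o (fun w => X s w * X t w)).
Proof.
move=> s0 t0.
apply: (le_integrable _ _ _ (integrable_EFinD (integrable_sqr s0) (integrable_sqr t0))) => //.
  by apply/measurable_EFinP; exact: measurable_funM.
move=> w _ /=; rewrite lee_fin; apply: le_trans (ler_norm _).
by rewrite ler_norml; apply/andP; split; nra.
Qed.

Lemma integrable_coord (t : R) : 0 <= t -> P.-integrable setT (EFin \o X t).
Proof.
move=> t0.
have i1 : P.-integrable setT (EFin \o cst (1 : R)) by exact: finite_measure_integrable_cst.
apply: (le_integrable _ _ _ (integrable_EFinD i1 (integrable_sqr t0))) => //.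
  exact/measurable_EFinP.
move=> w _ /=; rewrite lee_fin; apply: le_trans (ler_norm _).
by rewrite ler_norml; apply/andP; split; nra.
Qed.

Variables (n : nat) (t : 'I_n -> R) (a : 'I_n -> R).
Hypothesis t0 : forall i, 0 <= t i.

Let Y (w : Om) : R := \sum_(i < n) a i * X (t i) w.

Definition lincomb_var : R := \sum_(i < n) \sum_(j < n) a i * a j * C (t i) (t j).

Lemma lincomb_mean : P.-integrable setT (EFin \o Y) /\ (\int[P]_w (Y w)%:E = 0)%E.
Proof.
have i1 i : P.-integrable setT (fun w => (a i * X (t i) w)%:E).
  exact: (integrable_EFinZ (a i) (integrable_coord (t0 i))).
split.
  have : P.-integrable setT (fun w => \sum_(i < n) (a i * X (t i) w)%:E)%E.
    by apply: integrable_sum.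
  by apply: eq_integrable => // w _ /=; rewrite sumEFin.
rewrite /Y; under eq_integral do rewrite -sumEFin.
rewrite integral_sum//; apply: big1 => i _.
under eq_integral do rewrite EFinM.
rewrite integralZl//; last exact: integrable_coord.
have := gX.2 _ (t0 i); rewrite unlock => ->.
by rewrite mule0.
Qed.

Lemma lincomb_second_moment : (\int[P]_w (Y w ^+ 2)%:E = lincomb_var%:E)%E.
Proof.
have E w : (Y w ^+ 2)%:E = (\sum_(i < n) \sum_(j < n) ((a i * a j) * (X (t i) w * X (t j) w))%:E)%E.
  rewrite expr2 /Y mulr_suml -sumEFin; apply: eq_bigr => i _.
  rewrite mulr_sumr -sumEFin; apply: eq_bigr => j _.
  by congr EFin; ring.
under eq_integral do rewrite E.
have i2 i j : P.-integrable setT (fun w => ((a i * a j) * (X (t i) w * X (t j) w))%:E).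
  exact: (integrable_EFinZ _ (integrable_mul (t0 i) (t0 j))).
rewrite integral_sum//; last first.
  by move=> i; apply: integrable_sum.
rewrite /lincomb_var -sumEFin; apply: eq_bigr => i _.
rewrite integral_sum// -sumEFin; apply: eq_bigr => j _.
under eq_integral do rewrite EFinM.
rewrite integralZl//; last exact: integrable_mul.
have := cX (t0 i) (t0 j); rewrite unlock => ->.
by rewrite EFinM.
Qed.

Lemma lincomb_measurable : measurable_fun [set: Om] Y.
Proof. by case: lincomb_mean => /integrableP[/measurable_EFinP]. Qed.

(** In the expansion of [cos (Y + phi)] the sine part drops out by symmetry. The phase lets real
    cosines play the part of complex exponentials. *)
Lemma lincomb_cf (phi : R) :
  (\int[P]_w (cos (Y w + phi))%:E = (gauss_cf lincomb_var * cos phi)%:E)%E.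
Proof.
have [m [s law]] := gX.1 n t a t0.
have mY := lincomb_measurable.
have [iY EY] := lincomb_mean.
have [Ec Es] := gaussian_cf mY law EY iY lincomb_second_moment.
have ic : P.-integrable setT (EFin \o (fun w => cos (Y w))).
  apply: (@integrable_bounded _ _ _ _ _ 1).
    by apply: (measurableT_comp _ mY); apply: continuous_measurable_fun => x; exact: continuous_cos.
  by move=> x; rewrite ler_norml cos_geN1 cos_le1.
have is_ : P.-integrable setT (EFin \o (fun w => sin (Y w))).
  apply: (@integrable_bounded _ _ _ _ _ 1).
    by apply: (measurableT_comp _ mY); apply: continuous_measurable_fun => x; exact: continuous_sin.
  by move=> x; rewrite ler_norml sin_geN1 sin_le1.
under eq_integral do rewrite cosD mulrC (mulrC (sin _)) EFinB !EFinM.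
rewrite integralB//; last 2 first.
- exact: (integrable_EFinZ (cos phi) ic).
- exact: (integrable_EFinZ (sin phi) is_).
rewrite !integralZl//.
by rewrite Ec Es mule0 sube0 -EFinM mulrC.
Qed.

End GaussianProcess.

(** * Bernstein operators as binomial expectations *)

Section Bernstein.
Context {R : realFieldType}.

(* [bern m y g] is the expectation of [g] under the binomial law with parameters [m] and [y]. *)
Fixpoint bern (m : nat) (y : R) (g : nat -> R) : R :=
  if m is m'.+1 then y * bern m' y (fun k => g k.+1) + (1 - y) * bern m' y g
  else g 0%N.

Lemma bern_le m y g h : 0 <= y <= 1 -> (forall k, (k <= m)%N -> g k <= h k) ->
  bern m y g <= bern m y h.
Proof.
move=> /andP[y0 y1]; elim: m g h => [|m IH] g h gh /=; first exact: gh.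
apply: lerD; apply: ler_wpM2l => //; first by apply: IH => k km; exact: gh.
  by rewrite subr_ge0.
by apply: IH => k km; apply: gh; exact: leqW.
Qed.

(** The binomial law has mean [m y] and variance [m y (1 - y)]. The centre [c] is arbitrary because
    the recursion shifts it by one. *)
Lemma bern_quad m y (A B c : R) :
  bern m y (fun k => A + B * (k%:R - c) ^+ 2) =
  A + B * ((m%:R * y - c) ^+ 2 + m%:R * (y * (1 - y))).
Proof.
elim: m c => [|m IH] c /=; first by ring.
rewrite IH.
have E : (fun k => A + B * (k.+1%:R - c) ^+ 2) = (fun k => A + B * (k%:R - (c - 1)) ^+ 2).
  by apply/funext => k; rewrite -natr1; congr (_ + _ * _ ^+ 2); ring.
rewrite E IH -natr1; ring.
Qed.

(** Expectation of [g] under independent binomial laws with parameters [ys]: the Bernstein operator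
    in several variables. *)
Fixpoint mbern (m : nat) (ys : seq R) (g : seq nat -> R) : R :=
  if ys is y :: ys' then bern m y (fun k => mbern m ys' (fun ks => g (k :: ks)))
  else g [::].

(** The squared Euclidean distance from the node [ks / m] to [ys]; lists of unequal lengths are
    compared on their common part. *)
Fixpoint sqdist (m : nat) (ys : seq R) (ks : seq nat) : R :=
  match ys, ks with
  | y :: ys', k :: ks' => (k%:R / m%:R - y) ^+ 2 + sqdist m ys' ks'
  | _, _ => 0
  end.

Definition unit_seq (ys : seq R) := all (fun y => 0 <= y <= 1) ys.

Lemma mbern_le m ys g h : unit_seq ys ->
  (forall ks, size ks = size ys -> all (fun k => (k <= m)%N) ks -> g ks <= h ks) ->
  mbern m ys g <= mbern m ys h.
Proof.
elim: ys g h => [|y ys IH] g h /=; first by move=> _ /(_ [::]); exact.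
move=> /andP[y01 ys01] gh; apply: bern_le => // k km; apply: IH => // ks sk ak.
by apply: gh; rewrite /= ?sk// km.
Qed.

Lemma bernN m y g : bern m y (fun k => - g k) = - bern m y g.
Proof. by elim: m g => [//|m IH] g /=; rewrite (IH (fun k => g k.+1)) IH; ring. Qed.

Lemma mbernN m ys g : mbern m ys (fun ks => - g ks) = - mbern m ys g.
Proof.
elim: ys g => [//|y ys IH] g /=; rewrite -bernN; congr bern.
by apply/funext => k; rewrite (IH (fun ks => g (k :: ks))).
Qed.

(** Each coordinate of the random node has mean [y] and variance [y (1 - y) / m <= 1 / m]. The
    constant [A] is general because the induction absorbs the first coordinate into it. *)
Lemma mbern_sqdist m ys (A C : R) : (0 < m)%N -> unit_seq ys -> 0 <= C ->
  mbern m ys (fun ks => A + C * sqdist m ys ks) <= A + C * ((size ys)%:R / m%:R).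
Proof.
move=> m0 + C0; have m0' : 0 < m%:R :> R by rewrite ltr0n.
elim: ys A => [|y ys IH] A /=; first by move=> _; rewrite mul0r.
move=> /andP[y01 ys01].
apply: (@le_trans _ _ (bern m y (fun k =>
    (A + C * ((size ys)%:R / m%:R)) + C / m%:R ^+ 2 * (k%:R - m%:R * y) ^+ 2))).
  apply: bern_le => // k _.
  rewrite (_ : (fun ks => _) = (fun ks => (A + C * (k%:R / m%:R - y) ^+ 2) + C * sqdist m ys ks)).
    apply: le_trans (IH _ ys01) _.
    by rewrite le_eqVlt; apply/orP; left; apply/eqP; field; rewrite gt_eqF.
  by apply/funext => ks /=; rewrite mulrDr addrA.
rewrite bern_quad subrr expr0n/= add0r -subr_ge0.
rewrite (_ : _ - _ = C / m%:R * (1 - y * (1 - y))); last by rewrite -natr1; field; rewrite gt_eqF.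
apply: mulr_ge0; first by rewrite divr_ge0// ltW.
by case/andP: y01 => ? ?; nra.
Qed.

(** Chebyshev's argument without probabilities: monotonicity of the operator passes the quadratic
    bound from the nodes to the mean, where [mbern_sqdist] applies. *)
Lemma mbern_approx m ys (g : seq nat -> R) (v A C : R) :
  (0 < m)%N -> unit_seq ys -> 0 <= C ->
  (forall ks, size ks = size ys -> all (fun k => (k <= m)%N) ks ->
    `|v - g ks| <= A + C * sqdist m ys ks) ->
  `|v - mbern m ys g| <= A + C * ((size ys)%:R / m%:R).
Proof.
move=> m0 ys01 C0 h; rewrite ler_norml; apply/andP; split.
  suff : mbern m ys g <= (v + A) + C * ((size ys)%:R / m%:R) by lra.
  apply: le_trans (mbern_sqdist _ m0 ys01 C0).
  apply: mbern_le => // ks sk ak; have := h ks sk ak; rewrite ler_norml => /andP[? ?].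
  lra.
suff : - mbern m ys g <= (- v + A) + C * ((size ys)%:R / m%:R) by lra.
rewrite -mbernN.
apply: le_trans (mbern_sqdist _ m0 ys01 C0).
apply: mbern_le => // ks sk ak; have := h ks sk ak; rewrite ler_norml => /andP[? ?].
lra.
Qed.

End Bernstein.

(** * Trigonometric polynomials in several variables *)

Section TrigPolynomials.
Context {R : realType} {n : nat}.

(** Only sums of waves are built in, since these are what characteristic functions control; the
    products that occur are reduced to sums in [trig_sin]. *)
Inductive trig_poly : ('rV[R]_n -> R) -> Prop :=
| trig_wave (c : R) (a : 'I_n -> R) (phi : R) :
    trig_poly (fun x => c * cos (\sum_(i < n) a i * x 0 i + phi))
| trig_add F G : trig_poly F -> trig_poly G -> trig_poly (fun x => F x + G x).

Lemma trig_cst (c : R) : trig_poly (fun=> c).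
Proof.
have := trig_wave c (fun=> 0) 0; congr trig_poly; apply/funext => x.
by rewrite big1 ?addr0 ?cos0 ?mulr1// => i _; rewrite mul0r.
Qed.

Lemma trig_scale (c : R) F : trig_poly F -> trig_poly (fun x => c * F x).
Proof.
elim=> [c' a phi|{}F G _ IF _ IG].
  have := trig_wave (c * c') a phi; congr trig_poly; apply/funext => x.
  by rewrite mulrA.
by have := trig_add IF IG; congr trig_poly; apply/funext => x; rewrite mulrDr.
Qed.

Lemma trig_sin (c : R) (i : 'I_n) F : trig_poly F ->
  trig_poly (fun x => sin (c * x 0 i) * F x).
Proof.
elim=> [c' a phi|{}F G _ IF _ IG]; last first.
  by have := trig_add IF IG; congr trig_poly; apply/funext => x; rewrite mulrDr.
(* [2 cos X sin Y = sin (X + Y) - sin (X - Y)], each sine being a cosine delayed by [pi / 2]. *)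
have := trig_add (trig_wave (c' / 2) (fun j => a j + c * (j == i)%:R) (phi - pi / 2))
  (trig_wave (- (c' / 2)) (fun j => a j - c * (j == i)%:R) (phi - pi / 2)).
congr trig_poly; apply/funext => x.
set A := \sum_(j < n) a j * x 0 j.
have B (e : R) : \sum_(j < n) (a j + e * (j == i)%:R) * x 0 j = A + e * x 0 i.
  rewrite /A [in RHS](_ : x 0 i = \sum_(j < n) (j == i)%:R * x 0 j); last first.
    rewrite (bigD1 i)//= eqxx mul1r big1 ?addr0// => j /negPf->; exact: mul0r.
  rewrite mulr_sumr -big_split/=; apply: eq_bigr => j _; ring.
rewrite B; under eq_bigr do rewrite -mulNr; rewrite B.
rewrite (_ : A + c * x 0 i + (phi - pi / 2) = (A + phi + c * x 0 i) - pi / 2); last by ring.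
rewrite (_ : A + - c * x 0 i + (phi - pi / 2) = (A + phi - c * x 0 i) - pi / 2); last by ring.
rewrite !cosBpihalf sinB sinD; by field.
Qed.

(** It takes values in [[0, 1]], where Bernstein operators live, and is injective in [x 0 i] on
    [[-N, N]] because [1 <= pi / 2]. *)
Definition sin_coord (N : R) (i : 'I_n) (x : 'rV[R]_n) : R := (1 + sin (N^-1 * x 0 i)) / 2.

Lemma sin_coord01 N i x : 0 <= sin_coord N i x <= 1.
Proof.
have := sin_geN1 (N^-1 * x 0 i); have := sin_le1 (N^-1 * x 0 i).
by rewrite /sin_coord => ? ?; apply/andP; split; lra.
Qed.

(** This is the recursion step of [bern] at the parameter [sin_coord N i x]. *)
Lemma trig_sin_coord N i F G : trig_poly F -> trig_poly G ->
  trig_poly (fun x => sin_coord N i x * F x + (1 - sin_coord N i x) * G x).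
Proof.
move=> tF tG.
have := trig_add (trig_add (trig_scale 2^-1 tF) (trig_scale 2^-1 (trig_sin N^-1 i tF)))
  (trig_add (trig_scale 2^-1 tG) (trig_scale (- 2^-1) (trig_sin N^-1 i tG))).
by congr trig_poly; apply/funext => x; rewrite /sin_coord; field.
Qed.

Lemma trig_bern N i m (h : nat -> 'rV[R]_n -> R) : (forall k, trig_poly (h k)) ->
  trig_poly (fun x => bern m (sin_coord N i x) (fun k => h k x)).
Proof.
elim: m h => [|m IH] h th /=; first exact: th.
by apply: trig_sin_coord; exact: IH.
Qed.

Lemma trig_mbern N m (s : seq 'I_n) (g : seq nat -> R) :
  trig_poly (fun x => mbern m [seq sin_coord N i x | i <- s] g).
Proof.
elim: s g => [|i s IH] g /=; first exact: trig_cst.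
by apply: (@trig_bern N i m (fun k x => mbern m [seq sin_coord N i x | i <- s] (fun ks => g (k :: ks)))).
Qed.

End TrigPolynomials.

(** * Trigonometric approximation with a quadratic error *)

Section TrigApproximation.
Context {R : realType}.

(** Quantitative injectivity of sine. With [h] and [g] the half difference and half sum,
    [sin a - sin b = 2 cos g sin h], and [|g| <= pi / 2 - h] gives [cos g >= sin h]; finally
    [2 (sin h)^2 = 1 - cos (a - b)]. *)
Lemma sin_sub_ge (a b : R) : - (pi / 2) <= a <= pi / 2 -> - (pi / 2) <= b <= pi / 2 ->
  1 - cos (a - b) <= `|sin a - sin b|.
Proof.
wlog ba : a b / b <= a.
  move=> W ha hb; have [|/ltW ab] := leP b a; first by move=> ?; exact: W.
  by rewrite distrC -cosN opprB; exact: W.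
move=> /andP[a1 a2] /andP[b1 b2].
pose h := (a - b) / 2; pose g := (a + b) / 2.
have -> : a - b = h *+ 2 by rewrite /h mulr2n; field.
have ea : a = g + h by rewrite /h /g; field.
have eb : b = g - h by rewrite /h /g; field.
have -> : sin a - sin b = (cos g * sin h) *+ 2.
  by rewrite {1}ea {1}eb sinD sinB mulr2n; ring.
have pi0 := pi_gt0 R.
have h01 : 0 <= h <= pi / 2 by rewrite /h; apply/andP; split; lra.
have sh : 0 <= sin h.
  by apply: sin_ge0_pi; case/andP: h01 => ? ?; apply/andP; split; lra.
have cg : sin h <= cos g.
  have -> : sin h = cos (pi / 2 - h).
    by rewrite cosB cos_pihalf sin_pihalf mul0r mul1r add0r.
  have -> : cos g = cos `|g| by case: (ger0P g) => _; rewrite ?cosN.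
  have gh : `|g| <= pi / 2 - h.
    by rewrite ler_norml /g /h; apply/andP; split; lra.
  have gpi : `|g| \in `[0, pi] by rewrite in_itv/= normr_ge0/=; case/andP: h01 => ? ?; lra.
  have hpi : pi / 2 - h \in `[0, pi].
    by rewrite in_itv/=; case/andP: h01 => ? ?; apply/andP; split; lra.
  by rewrite leNgt; apply/negP; rewrite ltr_cos// ltNge gh.
rewrite cos_mulr2n cos2sin2; apply: le_trans (ler_norm _).
have := ler_wpM2r sh cg.
by rewrite !mulr2n expr2; lra.
Qed.

(** Only [x] is confined to the compact box: the node [z] to which it is compared may lie outside.
    This asymmetry is obtained from the near-covering form of compactness. *)
Lemma heine_rV n (f : 'rV[R]_n -> R) (A : 'I_n -> set R) (eps : R) :
  continuous f -> (forall i, compact (A i)) -> 0 < eps ->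
  exists2 delta, 0 < delta & forall x z : 'rV[R]_n, (forall i, A i (x 0 i)) ->
    (forall i, `|x 0 i - z 0 i| < delta) -> `|f x - f z| < eps.
Proof.
move=> cf cA e0.
have := rV_compact cA => /compact_near_coveringP.
move=> /(_ R (0^'+) (fun dl (x : 'rV[R]_n) => forall z : 'rV[R]_n,
  (forall i, `|x 0 i - z 0 i| < dl) -> `|f x - f z| < eps) _).
case.
  move=> x Ax.
  have e2 : 0 < eps / 2 by rewrite divr_gt0.
  have := cf x; move=> /cvgrPdist_lt/(_ _ e2) /nbhs_ballP[r /= r0 hr].
  have r2 : 0 < r / 2 by rewrite divr_gt0.
  exists ([set y | ball x (r / 2) y], [set t | 0 < t < r / 2]) => /=.
    split; first by apply/nbhs_ballP; exists (r / 2).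
    by near=> t; apply/andP; split; near: t; [exact: nbhs_right_gt|exact: nbhs_right_lt].
  move=> [y t] /= [xy /andP[t0 tr]] z yz.
  have yx : ball x r y by apply: le_ball xy; rewrite ler_pdivrMr// ler_peMr ?ler1n// ltW.
  have zx : ball x r z.
    apply: (@ball_split _ _ y) => //.
    split; first by rewrite divr_gt0.
    move=> i j; rewrite !(ord1 i); apply: lt_trans (yz j) tr.
  have := hr _ yx; have := hr _ zx => h1 h2.
  rewrite (_ : f y - f z = (f x - f z) - (f x - f y)); last by ring.
  rewrite (le_lt_trans (ler_normB _ _))// [ltRHS](splitr eps) ltrD//.
move=> dl /= dl0 hdl.
have dl2 : 0 < dl / 2 by rewrite divr_gt0.
exists (dl / 2) => // x z Ax xz.
apply: (hdl (dl / 2)) => //=.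
by rewrite sub0r normrN gtr0_norm// ltr_pdivrMr// ltr_pMr// ltr1n.
Unshelve. all: by end_near. Qed.

(** The point whose coordinates [sin_coord] are [ks / m]. It lies in the box of half-width
    [N pi / 2], not always in that of half-width [N]. *)
Definition sin_node (n : nat) (N : R) (m : nat) (ks : seq nat) : 'rV[R]_n :=
  \row_i (N * asin (2 * ((nth 0%N ks i)%:R / m%:R) - 1)).

Lemma sqdist_ge (m : nat) (ys : seq R) (ks : seq nat) (i : nat) :
  size ks = size ys -> (i < size ys)%N ->
  ((nth 0%N ks i)%:R / m%:R - nth 0 ys i) ^+ 2 <= sqdist m ys ks.
Proof.
have S0 (ys' : seq R) ks' : 0 <= sqdist m ys' ks'.
  elim: ys' ks' => [|y ys' IH] [|k ks'] //=.
  by rewrite addr_ge0 ?sqr_ge0.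
elim: ys ks i => [//|y ys IH] [//|k ks] [|i] /= [sk] ii.
  by rewrite lerDl.
by rewrite (le_trans (IH ks i sk ii))// lerDr sqr_ge0.
Qed.

Lemma trig_approx n (f : 'rV[R]_n -> R) (M N eps : R) :
  continuous f -> (forall x, `|f x| <= M) -> 0 < N -> 0 < eps ->
  exists2 Q, trig_poly Q & forall x : 'rV[R]_n,
    `|f x - Q x| <= eps + 2 * M / N ^+ 2 * \sum_(i < n) (x 0 i) ^+ 2.
Proof.
move=> cf fM N0 e0.
have M0 : 0 <= M by exact: le_trans (fM 0).
have pi0 := pi_gt0 R; have pi2 := pi_ge2 R.
have e2 : 0 < eps / 2 by rewrite divr_gt0.
have [dl' dl0' hdl'] := heine_rV cf (fun i : 'I_n => @segment_compact R (- N) N) e2.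
(* The cap at [N] puts [dl / N] into [[0, pi]], where cosine is monotone. *)
pose dl : R := Num.min dl' N.
have dl0 : 0 < dl by rewrite lt_min dl0' N0.
have hdl (x z : 'rV[R]_n) : (forall i, `[- N, N]%classic (x 0 i)) ->
    (forall i, `|x 0 i - z 0 i| < dl) -> `|f x - f z| < eps / 2.
  by move=> xN xz; apply: hdl' => // i; apply: lt_le_trans (xz i) _; rewrite ge_min lexx.
(* By [sin_sub_ge], a lower bound for the gap between the sines of two scaled coordinates at
   distance at least [dl / N]. *)
pose c := 1 - cos (dl / N).
have dlN : 0 < dl / N <= 1.
  by rewrite divr_gt0//= ler_pdivrMr// mul1r ge_min lexx orbT.
have c0 : 0 < c.
  rewrite subr_gt0 -[ltRHS]cos0 ltr_cos ?in_itv/= ?lexx ?(ltW pi0)//; case/andP: dlN => ? ?; lra.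
(* At a far node [sqdist] is at least [c^2 / 4], the 4 coming from the halving in [sin_coord]; so
   [C * (c^2 / 4) = 2 * M] bounds the error there. *)
pose C := 8 * M / c ^+ 2.
have C0 : 0 <= C by rewrite divr_ge0 ?mulr_ge0// ?exprn_ge0// ltW.
have [m m0 hm] : exists2 m : nat, (0 < m)%N & C * (n%:R / m%:R) <= eps / 2.
  pose k := Num.trunc (C * n%:R / (eps / 2)).
  exists k.+1 => //.
  have h : C * n%:R / (eps / 2) < k.+1%:R.
    by rewrite truncnS_gt.
  rewrite mulrA ler_pdivrMr ?ltr0n// -ler_pdivrMl// mulrC; exact: ltW.
pose ys (x : 'rV[R]_n) := [seq sin_coord N i x | i <- enum 'I_n].
exists (fun x => mbern m (ys x) (fun ks => f (sin_node n N m ks))).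
  exact: trig_mbern.
move=> x.
have ys01 : unit_seq (ys x).
  by apply/allP => y /mapP[i _ ->]; exact: sin_coord01.
have sys : size (ys x) = n by rewrite size_map size_enum_ord.
(* Outside the box the error is merely at most [2 * M], but one coordinate beyond [N] makes the
   quadratic term at least as large. *)
have [xN|] := pselect (forall i, `[- N, N]%classic (x 0 i)); last first.
  move=> /existsNP[i xi].
  have xi2 : N ^+ 2 <= x 0 i ^+ 2.
    rewrite -(real_normK (num_real (x 0 i))) ler_sqr ?nnegrE ?(ltW N0)//.
    by rewrite leNgt; apply/negP => /ltW; rewrite ler_norml => h; apply: xi; rewrite /= in_itv.
  apply: (@le_trans _ _ (2 * M)).
    rewrite (_ : 2 * M = (M + M) + 0 * ((size (ys x))%:R / m%:R)); last by ring.
    apply: mbern_approx => // ks _ _; rewrite mul0r addr0.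
    by rewrite (le_trans (ler_normB _ _))// lerD.
  have hs : N ^+ 2 <= \sum_(i < n) x 0 i ^+ 2.
    by rewrite (bigD1 i)//= (le_trans xi2)// lerDl sumr_ge0// => j _; exact: sqr_ge0.
  have N2 : 0 < N ^+ 2 by rewrite exprn_gt0.
  rewrite -[leLHS]add0r lerD// ?(ltW e0)// mulrAC ler_pdivlMr// ler_wpM2l//.
  by rewrite mulr_ge0.
have key : `|f x - mbern m (ys x) (fun ks => f (sin_node n N m ks))| <=
    eps / 2 + C * ((size (ys x))%:R / m%:R).
  apply: mbern_approx => // ks sk ak.
  (* Near nodes are handled by uniform continuity, far ones by the quadratic term. *)
  have [xz|] := pselect (forall i, `|x 0 i - sin_node n N m ks 0 i| < dl).
    have h := ltW (hdl _ _ xN xz).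
    apply: le_trans h _; rewrite lerDl mulr_ge0//.
    elim: (ys x) (ks) => [|y ys' IH] [|k ks'] //=.
    by rewrite addr_ge0 ?sqr_ge0.
  move=> /existsNP[i /negP]; rewrite -leNgt => xz.
  have ks_i : (nth 0%N ks i <= m)%N.
    by move/allP : ak; apply; rewrite mem_nth// sk sys.
  set y := (nth 0%N ks i)%:R / m%:R : R.
  have m0' : 0 < m%:R :> R by rewrite ltr0n.
  have y01 : 0 <= y <= 1.
    by rewrite divr_ge0//= ler_pdivrMr// mul1r ler_nat.
  have y11 : -1 <= 2 * y - 1 <= 1 by case/andP: y01 => ? ?; apply/andP; split; lra.
  pose a := x 0 i / N; pose b := asin (2 * y - 1).
  have a1 : -1 <= a <= 1.
    have := xN i; rewrite /= in_itv/= /a ler_pdivrMr// ler_pdivlMr// mul1r mulN1r.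
    by [].
  have ab : dl / N <= `|a - b|.
    rewrite ler_pdivrMr// -[X in _ * X](gtr0_norm N0) -normrM mulrBl divfK ?gt_eqF//.
    by move: xz; rewrite mxE -/y -/b mulrC.
  have b1 : - (pi / 2) <= b <= pi / 2 by rewrite asin_geNpi2// asin_lepi2.
  have a2 : - (pi / 2) <= a <= pi / 2.
    by case/andP: a1 => ? ?; apply/andP; split; lra.
  have cab : c <= `|sin a - sin b|.
    apply: le_trans (sin_sub_ge a2 b1); rewrite /c lerD2l lerN2.
    have -> : cos (a - b) = cos `|a - b| by case: (ger0P (a - b)) => _; rewrite ?cosN.
    have abpi : `|a - b| <= pi.
      by rewrite ler_norml; case/andP: a2 => ? ?; case/andP: b1 => ? ?; apply/andP; split; lra.
    have abi : `|a - b| \in `[0, pi] by rewrite in_itv/= normr_ge0.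
    have dli : dl / N \in `[0, pi].
      by rewrite in_itv/=; case/andP: dlN => ? ?; apply/andP; split; lra.
    by rewrite leNgt; apply/negP; rewrite ltr_cos// ltNge ab.
  have S : c ^+ 2 / 4 <= sqdist m (ys x) ks.
    have ii : (i < size (ys x))%N by rewrite sys.
    apply: le_trans (sqdist_ge m sk ii).
    rewrite (nth_map i) ?size_enum_ord// nth_ord_enum -/y /sin_coord.
    have -> : y = (1 + sin b) / 2.
      by rewrite asinK ?in_itv//; field.
    rewrite (_ : N^-1 * x 0 i = a); last by rewrite mulrC.
    rewrite [leRHS](_ : _ = (sin a - sin b) ^+ 2 / 4); last by field.
    rewrite ler_pM2r ?invr_gt0// -(real_normK (num_real (sin a - sin b))).
    by rewrite ler_sqr ?nnegrE// ltW.
  apply: (@le_trans _ _ (2 * M)).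
    by rewrite (le_trans (ler_normB _ _))// mulr_natl mulr2n lerD.
  apply: (@le_trans _ _ (C * (c ^+ 2 / 4))).
    by rewrite le_eqVlt /C; apply/orP; left; apply/eqP; field; rewrite gt_eqF.
  apply: (@le_trans _ _ (C * sqdist m (ys x) ks)); first by rewrite ler_wpM2l.
  by rewrite lerDr ltW.
rewrite sys in key.
apply: le_trans key _.
have Z0 : 0 <= 2 * M / N ^+ 2 * \sum_(i < n) x 0 i ^+ 2.
  apply: mulr_ge0; last by apply: sumr_ge0 => j _; exact: sqr_ge0.
  by apply: divr_ge0; [exact: mulr_ge0|exact: sqr_ge0].
by move: Z0 hm; set Z := _ * \sum_(_ < _) _; lra.
Qed.

End TrigApproximation.

(** * Bounded continuous functions of a random vector *)

Section TestFunctions.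
Context {R : realType} {d : measure_display} {Om : measurableType d} (P : probability Om R).
Context {n : nat} (Z : 'I_n -> Om -> R).
Hypothesis mZ : forall i, measurable_fun [set: Om] (Z i).

Lemma measurable_fin_sum (g : 'I_n -> Om -> R) :
  (forall i, measurable_fun [set: Om] (g i)) ->
  measurable_fun [set: Om] (fun w => \sum_(i < n) g i w).
Proof.
move=> mg.
have : forall s : seq 'I_n, measurable_fun [set: Om] (fun w => \sum_(i <- s) g i w).
  elim=> [|i s IH]; first by under eq_fun do rewrite big_nil; exact: measurable_cst.
  by under eq_fun do rewrite big_cons; apply: measurable_funD.
exact.
Qed.

Lemma trig_row_measurable Q : trig_poly Q ->
  measurable_fun [set: Om] (fun w => Q (\row_i Z i w)).
Proof.
elim=> [c a phi|F G _ mF _ mG]; last exact: measurable_funD.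
apply: measurable_funM => //.
apply: (measurableT_comp (f := @cos R)).
  by apply: continuous_measurable_fun => x; exact: continuous_cos.
apply: measurable_funD => //; apply: measurable_fin_sum => i.
by apply: measurable_funM => //; under eq_fun do rewrite mxE; exact: mZ.
Qed.

Lemma trig_bounded Q : trig_poly Q -> exists B, forall x : 'rV[R]_n, `|Q x| <= B.
Proof.
elim=> [c a phi|F G _ [B hB] _ [B' hB']].
  exists `|c| => x; rewrite normrM ler_piMr//.
  by rewrite ler_norml cos_geN1 cos_le1.
by exists (B + B') => x; rewrite (le_trans (ler_normD _ _))// lerD//.
Qed.

Lemma trig_row_integrable Q : trig_poly Q ->
  P.-integrable setT (EFin \o (fun w => Q (\row_i Z i w))).
Proof.
move=> tQ; have [B hB] := trig_bounded tQ.
by apply: (@integrable_bounded _ _ _ _ _ B) => //; exact: trig_row_measurable.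
Qed.

Variables (f : 'rV[R]_n -> R) (M : R).
Hypotheses (cf : continuous f) (fM : forall x, `|f x| <= M).

(** By [trig_approx] with [N = k + 1] and [eps = 1 / (k + 1)], [f] is a pointwise limit of
    trigonometric polynomials, for which measurability is elementary. *)
Lemma bounded_row_measurable : measurable_fun [set: Om] (fun w => f (\row_i Z i w)).
Proof.
have M0 : 0 <= M by exact: le_trans (fM 0).
have : forall k : nat, exists Q : 'rV[R]_n -> R, trig_poly Q /\ forall x : 'rV[R]_n,
    `|f x - Q x| <= k.+1%:R^-1 + 2 * M / k.+1%:R ^+ 2 * \sum_(i < n) (x 0 i) ^+ 2.
  move=> k.
  by have [//|//|Q tQ hQ] := @trig_approx R n f M k.+1%:R k.+1%:R^-1 cf fM; exists Q.
move=> /choice[Q hQ].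
apply: (@measurable_fun_cvg _ _ _ setT (fun k w => Q k (\row_i Z i w))).
  by move=> k; apply: trig_row_measurable; case: (hQ k).
move=> w _; set x := \row_i Z i w.
have cv1 : @harmonic R k @[k --> \oo] --> (0 : R) by exact: cvg_harmonic.
pose S := \sum_(i < n) x 0 i ^+ 2.
pose h k := harmonic k + 2 * M * (harmonic k * harmonic k) * S.
have ch : h k @[k --> \oo] --> (0 : R).
  rewrite (_ : 0 = 0 + 2 * M * (0 * 0) * S); last by ring.
  by apply: cvgD => //; apply: cvgMl; apply: cvgMr; exact: cvgM.
have hQk k : `|f x - Q k x| <= h k.
  have [_ /(_ x)] := hQ k; rewrite /h /harmonic/= -/S => le.
  by apply: le_trans le _; rewrite expr2 invfM mulrA.
apply: (@squeeze_cvgr _ _ _ _ (fun k => f x - h k) (fun k => f x + h k)).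
- by near=> k; have := hQk k; rewrite ler_norml => /andP[? ?]; apply/andP; split; lra.
- by rewrite -[X in _ --> X]subr0; apply: cvgB => //; exact: cvg_cst.
- by rewrite -[X in _ --> X]addr0; apply: cvgD => //; exact: cvg_cst.
Unshelve. all: by end_near. Qed.

Lemma bounded_row_integrable : P.-integrable setT (EFin \o (fun w => f (\row_i Z i w))).
Proof. exact: (integrable_bounded P bounded_row_measurable (fun w => fM _)). Qed.

Lemma expectation_approx (Q : 'rV[R]_n -> R) (e c B : R) : trig_poly Q -> 0 <= c ->
  (forall x, `|f x - Q x| <= e + c * \sum_(i < n) (x 0 i) ^+ 2) ->
  (\int[P]_w (\sum_(i < n) Z i w ^+ 2)%:E <= B%:E)%E ->
  `|\int[P]_w f (\row_i Z i w) - \int[P]_w Q (\row_i Z i w)| <= e + c * B.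
Proof.
move=> tQ c0 hQ hB.
have iQ := trig_row_integrable tQ; have iF := bounded_row_integrable.
have mS : measurable_fun [set: Om] (fun w => \sum_(i < n) Z i w ^+ 2).
  by apply: measurable_fin_sum => i; exact: measurable_funX.
have iS : P.-integrable setT (EFin \o (fun w => \sum_(i < n) Z i w ^+ 2)).
  have S0 w : 0 <= \sum_(i < n) Z i w ^+ 2 by apply: sumr_ge0 => i _; exact: sqr_ge0.
  apply/integrableP; split; first exact/measurable_EFinP.
  under eq_integral do rewrite /= (ger0_norm (S0 _)).
  by rewrite (le_lt_trans hB)// ltry.
have ie : P.-integrable setT (EFin \o cst e) by exact: finite_measure_integrable_cst.
have ib := integrable_EFinD ie (integrable_EFinZ c iS).
have iD := integrable_EFinB iF iQ.
rewrite -RintegralB//.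
apply: le_trans (le_normr_Rintegral measurableT iD) _.
apply: (@le_trans _ _ (\int[P]_w (e + c * \sum_(i < n) Z i w ^+ 2))).
  apply: le_Rintegral => //; first exact: (integrable_norm iD).
  by move=> w _; apply: le_trans (hQ _) _; under eq_bigr do rewrite mxE.
rewrite RintegralD//; last exact: integrable_EFinZ.
rewrite RintegralZl// Rintegral_cst//.
have -> : fine (P setT) = 1 by rewrite probability_setT.
rewrite mulr1 lerD2l ler_wpM2l// -lee_fin fineK//.
by apply: integrable_fin_num.
Qed.

End TestFunctions.

(** * Weak convergence from convergence of cosine integrals *)

Section WeakConvergence.
Context {R : realType} {d d' : measure_display} {Om : measurableType d} {Om' : measurableType d'}.
Variables (P : probability Om R) (P' : probability Om' R) (n : nat).
Variables (Z : R -> 'I_n -> Om -> R) (Y : 'I_n -> Om' -> R).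
Hypotheses (mZ : forall T i, measurable_fun [set: Om] (Z T i))
  (mY : forall i, measurable_fun [set: Om'] (Y i)).
Hypothesis cvg_cos : forall (a : 'I_n -> R) (phi : R),
  \int[P]_w cos (\sum_(i < n) a i * Z T i w + phi) @[T --> +oo] -->
  \int[P']_w cos (\sum_(i < n) a i * Y i w + phi).
Variable B : R.
Hypotheses (hZ : \forall T \near +oo, (\int[P]_w (\sum_(i < n) Z T i w ^+ 2)%:E <= B%:E)%E)
  (hY : (\int[P']_w (\sum_(i < n) Y i w ^+ 2)%:E <= B%:E)%E).

Lemma cvg_trig_poly Q : trig_poly Q ->
  \int[P]_w Q (\row_i Z T i w) @[T --> +oo] --> \int[P']_w Q (\row_i Y i w).
Proof.
elim=> [c a phi|F G tF IF tG IG].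
  have i1 T : P.-integrable setT
      (EFin \o (fun w => cos (\sum_(i < n) a i * (\row_i Z T i w) 0 i + phi))).
    have := trig_row_integrable P (mZ T) (trig_wave 1 a phi).
    by apply: eq_integrable => // w _ /=; rewrite mul1r.
  have i2 : P'.-integrable setT
      (EFin \o (fun w => cos (\sum_(i < n) a i * (\row_i Y i w) 0 i + phi))).
    have := trig_row_integrable P' mY (trig_wave 1 a phi).
    by apply: eq_integrable => // w _ /=; rewrite mul1r.
  have eY : \int[P']_w cos (\sum_(i < n) a i * (\row_i Y i w) 0 i + phi) =
      \int[P']_w cos (\sum_(i < n) a i * Y i w + phi).
    by apply: eq_Rintegral => w _; under eq_bigr do rewrite mxE.
  have eZ T : \int[P]_w cos (\sum_(i < n) a i * (\row_i Z T i w) 0 i + phi) =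
      \int[P]_w cos (\sum_(i < n) a i * Z T i w + phi).
    by apply: eq_Rintegral => w _; under eq_bigr do rewrite mxE.
  rewrite RintegralZl// eY.
  rewrite (_ : (fun T => _) = (fun T => c * \int[P]_w cos (\sum_(i < n) a i * Z T i w + phi))).
    by apply: cvgMr; exact: (@cvg_cos a phi).
  by apply/funext => T; rewrite RintegralZl// eZ.
rewrite RintegralD//; [|exact: trig_row_integrable..].
rewrite (_ : (fun T => _) = (fun T =>
    \int[P]_w F (\row_i Z T i w) + \int[P]_w G (\row_i Z T i w))).
  exact: cvgD.
by apply/funext => T; rewrite RintegralD//; exact: trig_row_integrable.
Qed.

Lemma cvg_bounded_continuous (f : 'rV[R]_n -> R) (M : R) :
  continuous f -> (forall x, `|f x| <= M) ->
  (\int[P]_w (f (\row_i Z T i w))%:E)%E @[T --> +oo] -->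
  (\int[P']_w (f (\row_i Y i w))%:E)%E.
Proof.
move=> cf fM.
have M0 : 0 <= M by exact: le_trans (fM 0).
have B0 : 0 <= B.
  rewrite -lee_fin; apply: le_trans hY; apply: integral_ge0 => w _.
  by rewrite lee_fin sumr_ge0// => i _; exact: sqr_ge0.
have iZ T := bounded_row_integrable P (mZ T) cf fM.
have iY := bounded_row_integrable P' mY cf fM.
have EZ T : (\int[P]_w (f (\row_i Z T i w))%:E = (\int[P]_w f (\row_i Z T i w))%:E)%E.
  by rewrite fineK//; apply: integrable_fin_num => //; exact: iZ.
have EY : (\int[P']_w (f (\row_i Y i w))%:E = (\int[P']_w f (\row_i Y i w))%:E)%E.
  by rewrite fineK//; apply: integrable_fin_num => //; exact: iY.
rewrite EY; under eq_fun do rewrite EZ.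
apply: cvg_EFin; first by near=> T.
apply/cvgrPdist_lt => /= eps eps0.
(* The budget: two approximation errors of at most [eps / 4] each, and [eps / 8] for the
   trigonometric polynomial. *)
have e8 : 0 < eps / 8 by rewrite divr_gt0.
(* The summand 1 gives [N^2 >= N], and the other one then gives [2 * M / N ^+ 2 * B <= eps / 8]. *)
pose N : R := 1 + 2 * M * B / (eps / 8).
have K0 : 0 <= 2 * M * B / (eps / 8) by rewrite divr_ge0 ?mulr_ge0// ltW.
have N1 : 1 <= N by rewrite /N lerDl.
have N0 : 0 < N by rewrite (lt_le_trans _ N1).
have [Q tQ hQ] := trig_approx cf fM N0 e8.
have c0 : 0 <= 2 * M / N ^+ 2 by apply: divr_ge0; [exact: mulr_ge0|exact: sqr_ge0].
have small : 2 * M / N ^+ 2 * B <= eps / 8.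
  rewrite mulrAC ler_pdivrMr ?exprn_gt0//.
  rewrite -ler_pdivrMl// mulrC.
  apply: (@le_trans _ _ N); first by rewrite /N lerDr.
  by rewrite expr2 ler_peMr// ltW.
have aY := expectation_approx mY cf fM tQ c0 hQ hY.
have cQ := cvg_trig_poly tQ; move/cvgrPdist_lt : cQ => /(_ _ e8) cQ.
near=> T.
have aZ : `|\int[P]_w f (\row_i Z T i w) - \int[P]_w Q (\row_i Z T i w)| <= eps / 8 + 2 * M / N ^+ 2 * B.
  by apply: (expectation_approx (mZ T) cf fM tQ c0 hQ); near: T.
have aQ : `|\int[P']_w Q (\row_i Y i w) - \int[P]_w Q (\row_i Z T i w)| < eps / 8.
  by near: T.
move: aY aZ aQ small.
move: (Rintegral _ _ _) (Rintegral _ _ _) (Rintegral _ _ _) (Rintegral _ _ _) => x1 x2 x3 x4.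
move: (2 * M / N ^+ 2 * B) => s.
rewrite !ler_norml !ltr_norml => /andP[? ?] /andP[? ?] /andP[? ?] ?.
by apply/andP; split; lra.
Unshelve. all: by end_near. Qed.

End WeakConvergence.

Lemma cvg_ord_sum (R : realType) (n : nat) (F : set_system R) {FF : Filter F}
    (u : 'I_n -> R -> R) (l : 'I_n -> R) : (forall i, u i x @[x --> F] --> l i) ->
  \sum_(i < n) u i x @[x --> F] --> \sum_(i < n) l i.
Proof.
move=> ul.
have : forall s : seq 'I_n, \sum_(i <- s) u i x @[x --> F] --> \sum_(i <- s) l i.
  elim=> [|i s IH].
    by rewrite big_nil; under eq_fun do rewrite big_nil; exact: cvg_cst.
  by rewrite big_cons; under eq_fun do rewrite big_cons; exact: cvgD.
exact.
Qed.

(** * Finite dimensional convergence from convergence of covariances *)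

Section FddCriterion.
Context {R : realType} {d d' : measure_display} {Om : measurableType d} {Om' : measurableType d'}.
Variables (P : probability Om R) (P' : probability Om' R).
Variables (rho : R -> {RV P >-> R}) (X : R -> {RV P' >-> R}) (C1 C2 : R -> R -> R).
Hypotheses (gr : centered_gaussian_process rho) (cr : has_covariance rho C1).
Hypotheses (gX : centered_gaussian_process X) (cX : has_covariance X C2).
Variables (r : R -> R) (K : R).

(** Symmetry comes from the process and not from the formula for [C1]: both values are the
    expectation of the same product. *)
Lemma has_covariance_sym (s t : R) : 0 <= s -> 0 <= t -> C1 s t = C1 t s.
Proof.
move=> s0 t0; have := cr s0 t0; have := cr t0 s0.
rewrite (_ : (fun w => _) = (fun w => rho s w * rho t w)) => [-> [->//]|].
by apply/funext => w; rewrite mulrC.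
Qed.

(* The covariance is symmetrised because the version [p 2] of the density need not be even: only
   the symmetrised energy of two intervals reduces to [min_integral]. *)
Hypothesis cvg_cov : forall s t : R, 0 <= s -> 0 <= t ->
  r T ^+ 2 * (C1 (T * s) (T * t) + C1 (T * t) (T * s)) @[T --> +oo] --> 2 * (K ^+ 2 * C2 s t).

Lemma cvg_cov1 (s t : R) : 0 <= s -> 0 <= t ->
  r T ^+ 2 * C1 (T * s) (T * t) @[T --> +oo] --> K ^+ 2 * C2 s t.
Proof.
move=> s0 t0.
have h : 2^-1 * (r T ^+ 2 * (C1 (T * s) (T * t) + C1 (T * t) (T * s))) @[T --> +oo]
    --> 2^-1 * (2 * (K ^+ 2 * C2 s t)) by apply: cvgMr; exact: cvg_cov.
rewrite mulKf// in h; apply: cvg_trans h; apply: near_eq_cvg; near=> T.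
have T0 : 0 <= T by near: T; exact: nbhs_pinfty_ge.
rewrite (has_covariance_sym (mulr_ge0 T0 t0) (mulr_ge0 T0 s0)); by field.
Unshelve. all: by end_near. Qed.

Lemma fdd_criterion : fdd_cvg P P' (fun T t w => r T * rho (T * t) w) (fun t w => K * X t w).
Proof.
move=> n t t0 f cf [M fM]; rewrite unlock.
(* The limit of the summed second moments, so that [L + 1] bounds them for large [T]. *)
pose L := \sum_(i < n) K ^+ 2 * C2 (t i) (t i).
have Tt0 (T : R) i : 0 <= T -> 0 <= T * t i by move=> T0; rewrite mulr_ge0.
apply: (@cvg_bounded_continuous _ _ _ _ _ P P' n
  (fun T i w => r T * rho (T * t i) w) (fun i w => K * X (t i) w) _ _ _ (L + 1) _ _ f M cf fM).
- by move=> T i; apply: measurable_funM.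
- by move=> i; apply: measurable_funM.
- move=> a phi.
  have eX : \int[P']_w cos (\sum_(i < n) a i * (K * X (t i) w) + phi) =
      gauss_cf (lincomb_var C2 t (fun i => a i * K)) * cos phi.
    have := lincomb_cf gX cX (fun i => a i * K) t0 phi => /(congr1 fine) /= <-.
    by apply: eq_Rintegral => w _; under [in RHS]eq_bigr do rewrite -mulrA.
  rewrite eX.
  (* The process is controlled at nonnegative times only, hence an equality for large [T]. *)
  have er : \forall T \near +oo,
      gauss_cf (lincomb_var C1 (fun i => T * t i) (fun i => a i * r T)) * cos phi =
      \int[P]_w cos (\sum_(i < n) a i * (r T * rho (T * t i) w) + phi).
    near=> T; have T0 : 0 <= T by near: T; exact: nbhs_pinfty_ge.
    have := lincomb_cf gr cr (fun i => a i * r T) (fun i => Tt0 T i T0) phi => /(congr1 fine) /= <-.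
    by apply: eq_Rintegral => w _; under eq_bigr do rewrite -mulrA.
  apply: cvg_trans; first exact: near_eq_cvg er.
  apply: cvgMl; apply: gauss_cf_cvgy.
  rewrite /lincomb_var; apply: cvg_ord_sum => i; apply: cvg_ord_sum => j.
  rewrite (_ : a i * K * (a j * K) * C2 (t i) (t j) = a i * a j * (K ^+ 2 * C2 (t i) (t j))); last by ring.
  rewrite (_ : (fun T => _) = (fun T => a i * a j * (r T ^+ 2 * C1 (T * t i) (T * t j)))).
    by apply: cvgMr; exact: cvg_cov1.
  by apply/funext => T; ring.
- have cL : \sum_(i < n) r T ^+ 2 * C1 (T * t i) (T * t i) @[T --> +oo] --> L.
    by apply: cvg_ord_sum => i; exact: cvg_cov1.
  have L1 : L < L + 1 by rewrite ltrDl.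
  near=> T; have T0 : 0 <= T by near: T; exact: nbhs_pinfty_ge.
  under eq_integral do rewrite -sumEFin.
  rewrite ge0_integral_sum//; last 2 first.
  - by move=> i; apply/measurable_EFinP; apply: measurable_funX; apply: measurable_funM.
  - by move=> i w _; rewrite lee_fin sqr_ge0.
  rewrite (eq_bigr (fun i => (r T ^+ 2 * C1 (T * t i) (T * t i))%:E)); last first.
    move=> i _; under eq_integral do rewrite exprMn EFinM.
    rewrite ge0_integralZl_EFin ?sqr_ge0//; last 2 first.
    - by move=> w _; rewrite lee_fin sqr_ge0.
    - by apply/measurable_EFinP; exact: measurable_funX.
    rewrite [RHS]EFinM -(cr (Tt0 T i T0) (Tt0 T i T0)) unlock.
    by congr (_ * _)%E; apply: eq_integral => w _; rewrite expr2.
  rewrite sumEFin lee_fin; near: T.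
  by move: cL => /cvgr_le; apply.
- rewrite (_ : \int[P']_w _ = L%:E)%E; first by rewrite lee_fin lerDl.
  under eq_integral do rewrite -sumEFin.
  rewrite ge0_integral_sum//; last 2 first.
  - by move=> i; apply/measurable_EFinP; apply: measurable_funX; apply: measurable_funM.
  - by move=> i w _; rewrite lee_fin sqr_ge0.
  rewrite /L -sumEFin; apply: eq_bigr => i _.
  under eq_integral do rewrite exprMn EFinM.
  rewrite ge0_integralZl_EFin ?sqr_ge0//; last 2 first.
  - by move=> w _; rewrite lee_fin sqr_ge0.
  - by apply/measurable_EFinP; exact: measurable_funX.
  rewrite [RHS]EFinM -(cX (t0 i) (t0 i)) unlock.
  by congr (_ * _)%E; apply: eq_integral => w _; rewrite expr2.
Unshelve. all: by end_near. Qed.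

End FddCriterion.

(** * The symmetrised covariances in the three cases *)

Section OccupationCovariance.
Context {R : realType} {d0 : measure_display} {Om0 : measurableType d0} {P0 : probability Om0 R}.
Variables (alpha : R) (theta : {RV P0 >-> nat}) (p : R -> R -> R).
Hypotheses (alpha_gt0 : 0 < alpha) (alpha_lt1 : alpha < 1).
Hypothesis var_theta : ('V_P0[(fun w => (theta w)%:R : R)%R] = 0)%E.
Hypothesis hp : stable_transition_density alpha p.

Definition mean_theta : R := fine ('E_P0[(fun w => (theta w)%:R : R)])%E.

Lemma mean_theta_ge0 : 0 <= mean_theta.
Proof. by apply: fine_ge0; apply: expectation_ge0 => w; rewrite ler0n. Qed.

Lemma cov_rho_energy psi s t :
  cov_rho theta p psi s t = mean_theta * energy (p 2) (psi s) (psi t).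
Proof.
rewrite /cov_rho/= var_theta /energy -/mean_theta /= sub0r mulNr mulrBr.
by [].
Qed.

Lemma density2 : [/\ measurable_fun [set: R] (p 2), (forall x, 0 <= p 2 x),
  (\int[lebesgue_measure]_x (p 2 x)%:E = 1)%E &
  forall z : R, (\int[lebesgue_measure]_x (cos (z * x) * p 2 x)%:E
                       = (expR (- 2 * `|z| `^ alpha))%:E)%E].
Proof. by have [] := hp (ltr0n R 2). Qed.

Local Notation M v := (min_integral (p 2) v).

Lemma min_integralN v : M (- v) = M v.
Proof. by rewrite -min_integral_norm normrN min_integral_norm. Qed.

Lemma cvg_normalized v : ((Num.sqrt (T `^ (1 - alpha)))^-1) ^+ 2 * M (T * v) @[T --> +oo] -->
  scaling_const alpha * `|v| `^ (1 - alpha).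
Proof.
have [mp p0 p1 pc] := density2.
rewrite (_ : (fun T => _) = (fun T => M (T * v) / T `^ (1 - alpha))).
  exact: (@cvg_min_integral R alpha (p 2) alpha_gt0 alpha_lt1 mp p0 p1 pc v).
by apply/funext => T; rewrite exprVn sqr_sqrtr ?powR_ge0// mulrC.
Qed.

Lemma cov_xi_sum s t : 0 <= s -> 0 <= t ->
  let psi := (fun t => \1_(`[0, t] : set R)) : R -> R -> R in
  cov_rho theta p psi s t + cov_rho theta p psi t s =
  mean_theta * (M s + M t - M (t - s)).
Proof.
move=> s0 t0 /=; have [mp p0 p1 _] := density2.
rewrite !cov_rho_energy -mulrDr energy_ind_sym// subr0 sub0r subrr min_integralN min_integral0.
by rewrite subr0 -(opprB t s) min_integralN.
Qed.

Lemma cov_eta_sum s t : 0 <= s -> 0 <= t ->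
  let psi := (fun t => \1_(`[- t, t] : set R)) : R -> R -> R in
  cov_rho theta p psi s t + cov_rho theta p psi t s =
  mean_theta * (2 * M (s + t) - 2 * M (t - s)).
Proof.
move=> s0 t0 /=; have [mp p0 p1 _] := density2.
rewrite !cov_rho_energy -mulrDr energy_ind_sym//; [|lra|lra].
rewrite !opprK -opprD min_integralN (addrC (- s) t) -(opprB t s) min_integralN.
by congr (_ * _); ring.
Qed.

(** Bilinearity gives eight energies, which pair up into four symmetrised ones; the mixed pairs
    enter with a minus sign. *)
Lemma cov_zeta_sum s t : 0 <= s -> 0 <= t ->
  let psi := (fun t x => \1_(`[0, t] : set R) x - \1_(`[- t, 0] : set R) x) : R -> R -> R in
  cov_rho theta p psi s t + cov_rho theta p psi t s =
  mean_theta * (4 * M s + 4 * M t - 2 * M (s + t) - 2 * M (t - s)).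
Proof.
move=> s0 t0 /=; have [mp p0 p1 _] := density2.
have sN : - s <= 0 by rewrite oppr_le0.
have tN : - t <= 0 by rewrite oppr_le0.
rewrite !cov_rho_energy -mulrDr !energyB//; congr (_ * _).
have e1 := energy_ind_sym mp p0 p1 s0 t0.
have e2 := energy_ind_sym mp p0 p1 s0 tN.
have e3 := energy_ind_sym mp p0 p1 sN t0.
have e4 := energy_ind_sym mp p0 p1 sN tN.
have m0 : M 0 = 0 by exact: min_integral0.
move: e1 e2 e3 e4; do 8! move: (energy _ _ _) => ?.
rewrite !(subr0, sub0r, add0r, opprK, subrr) -(opprB t s) (_ : - s + t = t - s); last by ring.
rewrite (_ : - s - t = - (s + t)); last by ring.
rewrite !min_integralN m0.
lra.
Qed.

End OccupationCovariance.

(** * The three scaling limits *)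

Theorem proposition2p6 (R : realType) (alpha : R)
    (alpha_gt0 : 0 < alpha) (alpha_lt1 : alpha < 1)
    (d0 : measure_display) (Om0 : measurableType d0) (P0 : probability Om0 R)
    (theta : {RV P0 >-> nat})
    (var_theta : ('V_P0[(fun w => (theta w)%:R : R)%R] = 0)%E) :
  let H : R := (1 - alpha) / 2 in
  [/\ fdd_scaling_limit alpha theta
        (fun t => \1_(`[0, t] : set R)) (cov_xi H),
      fdd_scaling_limit alpha theta
        (fun t x => \1_(`[0, t] : set R) x - \1_(`[- t, 0] : set R) x)
        (cov_zeta H)
    & fdd_scaling_limit alpha theta
        (fun t => \1_(`[- t, t] : set R)) (cov_eta H)].
Proof.
move=> H.
have e0 := mean_theta_ge0 theta.
have c0 := scaling_const_ge0 alpha_gt0 alpha_lt1.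
have ec0 := mulr_ge0 e0 c0.
have H2 : 2 * H = 1 - alpha by rewrite /H; field.
split.
(* The factor 1/2 in [cov_xi] cancels the 2 of the symmetrisation, so [K^2] is just this product,
   which does not involve [p]. *)
- exists (Num.sqrt (mean_theta theta * scaling_const alpha))
    => p hp d Om P rho gr cr d' Om' P' X gX cX _.
  apply: (fdd_criterion gr cr gX cX) => s t s0 t0.
  rewrite sqr_sqrtr// /cov_xi H2.
  have l v := cvg_normalized alpha_gt0 alpha_lt1 hp v.
  apply: (@cvg_trans _ (((fun T => mean_theta theta *
      ((Num.sqrt (T `^ (1 - alpha)))^-1 ^+ 2 * min_integral (p 2) (T * s)
      + (Num.sqrt (T `^ (1 - alpha)))^-1 ^+ 2 * min_integral (p 2) (T * t)
      - (Num.sqrt (T `^ (1 - alpha)))^-1 ^+ 2 * min_integral (p 2) (T * (t - s)))) @ +oo%R))).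
    apply: near_eq_cvg; near=> T; have T0 : 0 <= T by near: T; exact: nbhs_pinfty_ge.
    rewrite (cov_xi_sum var_theta hp (mulr_ge0 T0 s0) (mulr_ge0 T0 t0)) (mulrBr T t s).
    by ring.
  rewrite (_ : 2 * _ = mean_theta theta * (scaling_const alpha * `|s| `^ (1 - alpha)
    + scaling_const alpha * `|t| `^ (1 - alpha) - scaling_const alpha * `|t - s| `^ (1 - alpha))).
    by apply: cvgMr; apply: cvgB; [apply: cvgD|]; exact: l.
  by rewrite (ger0_norm s0) (ger0_norm t0); field.
- have H1 : 0 < 1 - H by rewrite /H; lra.
  have K0 : 0 <= 2 * (mean_theta theta * scaling_const alpha) / (1 - H).
    by apply: divr_ge0; [exact: mulr_ge0|exact: ltW].
  (* The symmetrised covariance tends to four times [mean_theta theta * scaling_const alpha] times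
     the bracket in [cov_zeta]; halving, and dividing by the prefactor [1 - H], gives [K^2]. *)
  exists (Num.sqrt (2 * (mean_theta theta * scaling_const alpha) / (1 - H)))
    => p hp d Om P rho gr cr d' Om' P' X gX cX _.
  apply: (fdd_criterion gr cr gX cX) => s t s0 t0.
  rewrite sqr_sqrtr// /cov_zeta H2.
  have l v := cvg_normalized alpha_gt0 alpha_lt1 hp v.
  apply: (@cvg_trans _ (((fun T => mean_theta theta *
      (4 * ((Num.sqrt (T `^ (1 - alpha)))^-1 ^+ 2 * min_integral (p 2) (T * s))
      + 4 * ((Num.sqrt (T `^ (1 - alpha)))^-1 ^+ 2 * min_integral (p 2) (T * t))
      - 2 * ((Num.sqrt (T `^ (1 - alpha)))^-1 ^+ 2 * min_integral (p 2) (T * (s + t)))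
      - 2 * ((Num.sqrt (T `^ (1 - alpha)))^-1 ^+ 2 * min_integral (p 2) (T * (t - s))))) @ +oo%R))).
    apply: near_eq_cvg; near=> T; have T0 : 0 <= T by near: T; exact: nbhs_pinfty_ge.
    rewrite (cov_zeta_sum var_theta hp (mulr_ge0 T0 s0) (mulr_ge0 T0 t0)) (mulrBr T t s) (mulrDr T s t).
    by ring.
  rewrite (_ : 2 * _ = mean_theta theta * (4 * (scaling_const alpha * `|s| `^ (1 - alpha))
    + 4 * (scaling_const alpha * `|t| `^ (1 - alpha)) - 2 * (scaling_const alpha * `|s + t| `^ (1 - alpha))
    - 2 * (scaling_const alpha * `|t - s| `^ (1 - alpha)))).
    by apply: cvgMr; apply: cvgB; [apply: cvgB; [apply: cvgD|]|]; apply: cvgMr; exact: l.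
  by rewrite (ger0_norm s0) (ger0_norm t0) (ger0_norm (addr_ge0 s0 t0)); field; rewrite gt_eqF.
(* [cov_eta] lacks the factor 1/2 of [cov_xi], but the symmetrised covariance of the intervals
   [[-t, t]] carries a factor 2, so the constant is the same. *)
- exists (Num.sqrt (mean_theta theta * scaling_const alpha))
    => p hp d Om P rho gr cr d' Om' P' X gX cX _.
  apply: (fdd_criterion gr cr gX cX) => s t s0 t0.
  rewrite sqr_sqrtr// /cov_eta H2.
  have l v := cvg_normalized alpha_gt0 alpha_lt1 hp v.
  apply: (@cvg_trans _ (((fun T => mean_theta theta *
      (2 * ((Num.sqrt (T `^ (1 - alpha)))^-1 ^+ 2 * min_integral (p 2) (T * (s + t)))
      - 2 * ((Num.sqrt (T `^ (1 - alpha)))^-1 ^+ 2 * min_integral (p 2) (T * (t - s))))) @ +oo%R))).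
    apply: near_eq_cvg; near=> T; have T0 : 0 <= T by near: T; exact: nbhs_pinfty_ge.
    rewrite (cov_eta_sum var_theta hp (mulr_ge0 T0 s0) (mulr_ge0 T0 t0)) (mulrBr T t s) (mulrDr T s t).
    by ring.
  rewrite (_ : 2 * _ = mean_theta theta * (2 * (scaling_const alpha * `|s + t| `^ (1 - alpha))
    - 2 * (scaling_const alpha * `|t - s| `^ (1 - alpha)))).
    by apply: cvgMr; apply: cvgB; apply: cvgMr; exact: l.
  by rewrite (ger0_norm (addr_ge0 s0 t0)); ring.
Unshelve. all: by end_near. Qed.
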